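(* Let $A\in\mathbb{H}^{m\times n}$, $B\in\mathbb{H}^{m\times p_1}$, $C\in\mathbb{H}^{m\times p_2}$, $D\in\mathbb{H}^{q_1\times n}$ and $E\in\mathbb{H}^{q_2\times n}$ be given. Then there exist nonsingular matrices $P\in\mathbb{H}^{m\times m}$, $Q\in\mathbb{H}^{n\times n}$, $T_1\in\mathbb{H}^{p_1\times p_1}$, $T_2\in\mathbb{H}^{p_2\times p_2}$, $V_1\in\mathbb{H}^{q_1\times q_1}$, $V_2\in\mathbb{H}^{q_2\times q_2}$ such that $$A=PS_AQ,\quad B=PS_BT_1,\quad C=PS_CT_2,\quad D=V_1S_DQ,\quad E=V_2S_EQ,$$ where $$S_A=\begin{bmatrix}0&0&0&0&0&I_{m_1}&0\\ 0&A_1&A_2&A_3&0&0&0\\ 0&A_4&A_5&A_6&0&0&0\\ 0&A_7&A_8&A_9&0&0&0\\ 0&0&0&0&I_{m_5}&0&0\\ I_{m_6}&0&0&0&0&0&0\\ 0&0&0&0&0&0&0\end{bmatrix},\quad S_B=\begin{bmatrix}0&0&B_1\\ I_{m_2}&0&0\\ 0&I_{m_3}&0\\ 0&0&0\\ 0&0&0\\ 0&0&0\\ 0&0&0\end{bmatrix},\quad S_C=\begin{bmatrix}C_1&C_2&0\\ 0&0&0\\ 0&I_{m_3}&0\\ 0&0&I_{m_4}\\ 0&0&0\\ 0&0&0\\ 0&0&0\end{bmatrix},$$ $$S_D=\begin{bmatrix}0&I_{n_2}&0&0&0&0&0\\ 0&0&I_{n_3}&0&0&0&0\\ D_1&0&0&0&0&0&0\end{bmatrix},\quad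 S_E=\begin{bmatrix}E_1&0&0&0&0&0&0\\ E_2&0&I_{n_3}&0&0&0&0\\ 0&0&0&I_{n_4}&0&0&0\end{bmatrix},$$ for some quaternion matrices $A_1,\dots,A_9,B_1,C_1,C_2,D_1,E_1,E_2$ and nonnegative integers $m_1,\dots,m_6,n_2,n_3,n_4$ satisfying $$m_1+m_5+m_6=r\begin{bmatrix}A&B&C\end{bmatrix}+r\begin{bmatrix}A\\ D\\ E\end{bmatrix}-r\begin{bmatrix}A&B&C\\ D&0&0\\ E&0&0\end{bmatrix},$$ $$m_2=r\begin{bmatrix}A&B&C\\ D&0&0\\ E&0&0\end{bmatrix}-r\begin{bmatrix}A&C\\ D&0\\ E&0\end{bmatrix},\qquad m_4=r\begin{bmatrix}A&B&C\\ D&0&0\\ E&0&0\end{bmatrix}-r\begin{bmatrix}A&B\\ D&0\\ E&0\end{bmatrix},$$ $$m_3=r\begin{bmatrix}A&B\\ D&0\\ E&0\end{bmatrix}+r\begin{bmatrix}A&C\\ D&0\\ E&0\end{bmatrix}-r\begin{bmatrix}A&B&C\\ D&0&0\\ E&0&0\end{bmatrix}-r\begin{bmatrix}A\\ D\\ E\end{bmatrix},$$ $$n_2=r\begin{bmatrix}A&B&C\\ D&0&0\\ E&0&0\end{bmatrix}-r\begin{bmatrix}A&B&C\\ E&0&0\end{bmatrix},\qquad n_4=r\begin{bmatrix}A&B&C\\ D&0&0\\ E&0&0\end{bmatrix}-r\begin{bmatrix}A&B&C\\ D&0&0\end{bmatrix},$$ $$n_3=r\begin{bmatrix}A&B&C\\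 D&0&0\end{bmatrix}+r\begin{bmatrix}A&B&C\\ E&0&0\end{bmatrix}-r\begin{bmatrix}A&B&C\\ D&0&0\\ E&0&0\end{bmatrix}-r\begin{bmatrix}A&B&C\end{bmatrix}.$$
   Context: $\mathbb{H}$ is the real quaternion algebra and $\mathbb{H}^{m\times n}$ is the set of $m\times n$ matrices over $\mathbb{H}$. The rank $r(M)$ of a quaternion matrix $M$ is the dimension of its column right space (equivalently, of its row left space). $I_s$ is the $s\times s$ identity matrix; blocks are allowed to be empty (of size zero). The block partitions are as follows: the seven block rows of $S_A,S_B,S_C$ have sizes $m_1,m_2,m_3,m_4,m_5,m_6,\,m-\sum_{i=1}^6 m_i$; the seven block columns of $S_A,S_D,S_E$ have sizes $m_6,n_2,n_3,n_4,m_5,m_1,\,n-(m_1+m_5+m_6+n_2+n_3+n_4)$; the block columns of $S_B$ have sizes $m_2,m_3,p_1-m_2-m_3$; the block columns of $S_C$ have sizes $p_2-m_3-m_4,m_3,m_4$; the block rows of $S_D$ have sizes $n_2,n_3,q_1-n_2-n_3$; the block rows of $S_E$ have sizes $q_2-n_3-n_4,n_3,n_4$. *)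

(* Defs.v *)
From HB Require Import structures.
From mathcomp Require Import all_boot all_order all_algebra.
From mathcomp Require Import boolp classical_sets reals.
From mathcomp Require Import ring.

Set Implicit Arguments.
Unset Strict Implicit.
Unset Printing Implicit Defensive.

Import GRing.Theory.
Local Open Scope ring_scope.

(* Quat a b c d is a + b i + c j + d k. *)
Record quaternion (R : Type) := Quat { qre : R; qi : R; qj : R; qk : R }.

Section QuaternionRing.
Variable R : comNzRingType.
Local Notation H := (quaternion R).
Implicit Types x y z : H.

Definition quat_to_tuple x : R * R * R * R := (qre x, qi x, qj x, qk x).
Definition quat_of_tuple (t : R * R * R * R) : H :=
  let: (a, b, c, d) := t in Quat a b c d.
Lemma quat_to_tupleK : cancel quat_to_tuple quat_of_tuple.
Proof. by case. Qed.
HB.instance Definition _ := Choice.copy H (can_type quat_to_tupleK).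

Definition addq x y :=
  Quat (qre x + qre y) (qi x + qi y) (qj x + qj y) (qk x + qk y).
Definition oppq x := Quat (- qre x) (- qi x) (- qj x) (- qk x).
Definition mulq x y :=
  let: Quat a1 b1 c1 d1 := x in
  let: Quat a2 b2 c2 d2 := y in
  Quat (a1 * a2 - b1 * b2 - c1 * c2 - d1 * d2)
       (a1 * b2 + b1 * a2 + c1 * d2 - d1 * c2)
       (a1 * c2 - b1 * d2 + c1 * a2 + d1 * b2)
       (a1 * d2 + b1 * c2 - c1 * b2 + d1 * a2).

Lemma addqA : associative addq.
Proof. by move=> [????] [????] [????]; rewrite /addq /= !addrA. Qed.
Lemma addqC : commutative addq.
Proof. by move=> [????] [????]; congr Quat; exact: addrC. Qed.
Lemma add0q : left_id (Quat 0 0 0 0) addq.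
Proof. by move=> [????]; rewrite /addq /= !add0r. Qed.
Lemma addNq : left_inverse (Quat 0 0 0 0) oppq addq.
Proof. by move=> [????]; rewrite /addq /= !addNr. Qed.
HB.instance Definition _ := GRing.isZmodule.Build H addqA addqC add0q addNq.

Lemma mulqA : associative mulq.
Proof. by move=> [????] [????] [????]; congr Quat; ring. Qed.
Lemma mul1q : left_id (Quat 1 0 0 0) mulq.
Proof. by move=> [????]; congr Quat; ring. Qed.
Lemma mulq1 : right_id (Quat 1 0 0 0) mulq.
Proof. by move=> [????]; congr Quat; ring. Qed.
Lemma mulqDl : left_distributive mulq addq.
Proof. by move=> [????] [????] [????]; congr Quat; rewrite /=; ring. Qed.
Lemma mulqDr : right_distributive mulq addq.
Proof. by move=> [????] [????] [????]; congr Quat; rewrite /=; ring. Qed.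
Lemma oneq_neq0 : Quat 1 0 0 0 != 0 :> H.
Proof. by apply/eqP=> -[] /eqP; rewrite oner_eq0. Qed.
HB.instance Definition _ := GRing.Zmodule_isNzRing.Build H
  mulqA mul1q mulq1 mulqDl mulqDr oneq_neq0.

Lemma hamilton_relations :
  let i : H := Quat 0 1 0 0 in
  let j : H := Quat 0 0 1 0 in
  let k : H := Quat 0 0 0 1 in
  [/\ i * i = -1, j * j = -1, k * k = -1 & i * j * k = -1].
Proof. by split; congr Quat; rewrite /=; ring. Qed.

End QuaternionRing.

(* Linear algebra over a possibly noncommutative ring K: vectors are columns,
   and scalars act on them on the right. *)
Section NoncommutativeMatrices.
Variable K : nzRingType.

Definition nonsingular n (P : 'M[K]_n) : Prop :=
  exists P' : 'M[K]_n, P *m P' = 1%:M /\ P' *m P = 1%:M.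

(* M *m x is the right linear combination of the columns of M with
   coefficients x. *)
Definition colspace m n (M : 'M[K]_(m, n)) : set 'cV[K]_m :=
  [set M *m x | x in [set: 'cV[K]_n]]%classic.

(* The d columns of V form a basis of the right subspace S. *)
Definition right_basis m d (S : set 'cV[K]_m) (V : 'M[K]_(m, d)) : Prop :=
  (forall x : 'cV[K]_d, V *m x = 0 -> x = 0) /\ colspace V = S.

(* Over a division ring every column space has a basis, and all its bases have
   the same number of elements; the default value 0 is then never used. *)
Definition right_dim m (S : set 'cV[K]_m) : nat :=
  xget 0%N [set d | exists V : 'M[K]_(m, d), right_basis S V]%classic.

Definition rank m n (M : 'M[K]_(m, n)) : nat := right_dim (colspace M).

Definition row3 h c1 c2 c3 (X1 : 'M[K]_(h, c1)) (X2 : 'M[K]_(h, c2))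
    (X3 : 'M[K]_(h, c3)) : 'M[K]_(h, c1 + c2 + c3) :=
  row_mx (row_mx X1 X2) X3.

Definition col3 h1 h2 h3 c (X1 : 'M[K]_(h1, c)) (X2 : 'M[K]_(h2, c))
    (X3 : 'M[K]_(h3, c)) : 'M[K]_(h1 + h2 + h3, c) :=
  col_mx (col_mx X1 X2) X3.

Definition row7 h c1 c2 c3 c4 c5 c6 c7
    (X1 : 'M[K]_(h, c1)) (X2 : 'M[K]_(h, c2)) (X3 : 'M[K]_(h, c3))
    (X4 : 'M[K]_(h, c4)) (X5 : 'M[K]_(h, c5)) (X6 : 'M[K]_(h, c6))
    (X7 : 'M[K]_(h, c7)) : 'M[K]_(h, c1 + c2 + c3 + c4 + c5 + c6 + c7) :=
  row_mx (row_mx (row_mx (row_mx (row3 X1 X2 X3) X4) X5) X6) X7.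

Definition col7 h1 h2 h3 h4 h5 h6 h7 c
    (X1 : 'M[K]_(h1, c)) (X2 : 'M[K]_(h2, c)) (X3 : 'M[K]_(h3, c))
    (X4 : 'M[K]_(h4, c)) (X5 : 'M[K]_(h5, c)) (X6 : 'M[K]_(h6, c))
    (X7 : 'M[K]_(h7, c)) : 'M[K]_(h1 + h2 + h3 + h4 + h5 + h6 + h7, c) :=
  col_mx (col_mx (col_mx (col_mx (col3 X1 X2 X3) X4) X5) X6) X7.

(* In the five canonical forms below, m7 and n7 are the sizes of the last block
   row and block column of S_A, and p, q are the sizes of the block column or
   row of S_B, S_C, S_D, S_E that contains no identity block. *)
Definition S_A m1 m2 m3 m4 m5 m6 m7 n2 n3 n4 n7
    (A1 : 'M[K]_(m2, n2)) (A2 : 'M[K]_(m2, n3)) (A3 : 'M[K]_(m2, n4))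
    (A4 : 'M[K]_(m3, n2)) (A5 : 'M[K]_(m3, n3)) (A6 : 'M[K]_(m3, n4))
    (A7 : 'M[K]_(m4, n2)) (A8 : 'M[K]_(m4, n3)) (A9 : 'M[K]_(m4, n4)) :
    'M[K]_(m1 + m2 + m3 + m4 + m5 + m6 + m7,
           m6 + n2 + n3 + n4 + m5 + m1 + n7) :=
  col7
    (row7 0     0  0  0  0     1%:M 0)
    (row7 0     A1 A2 A3 0     0    0)
    (row7 0     A4 A5 A6 0     0    0)
    (row7 0     A7 A8 A9 0     0    0)
    (row7 0     0  0  0  1%:M  0    0)
    (row7 1%:M  0  0  0  0     0    0)
    (row7 0     0  0  0  0     0    0).

Definition S_B m1 m2 m3 m4 m5 m6 m7 p (B1 : 'M[K]_(m1, p)) :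
    'M[K]_(m1 + m2 + m3 + m4 + m5 + m6 + m7, m2 + m3 + p) :=
  col7
    (row3 0    0    B1)
    (row3 1%:M 0    0)
    (row3 0    1%:M 0)
    (row3 0    0    0)
    (row3 0    0    0)
    (row3 0    0    0)
    (row3 0    0    0).

Definition S_C m1 m2 m3 m4 m5 m6 m7 p
    (C1 : 'M[K]_(m1, p)) (C2 : 'M[K]_(m1, m3)) :
    'M[K]_(m1 + m2 + m3 + m4 + m5 + m6 + m7, p + m3 + m4) :=
  col7
    (row3 C1 C2   0)
    (row3 0  0    0)
    (row3 0  1%:M 0)
    (row3 0  0    1%:M)
    (row3 0  0    0)
    (row3 0  0    0)
    (row3 0  0    0).

Definition S_D m1 m5 m6 n2 n3 n4 n7 q (D1 : 'M[K]_(q, m6)) :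
    'M[K]_(n2 + n3 + q, m6 + n2 + n3 + n4 + m5 + m1 + n7) :=
  col3
    (row7 0  1%:M 0    0 0 0 0)
    (row7 0  0    1%:M 0 0 0 0)
    (row7 D1 0    0    0 0 0 0).

Definition S_E m1 m5 m6 n2 n3 n4 n7 q
    (E1 : 'M[K]_(q, m6)) (E2 : 'M[K]_(n3, m6)) :
    'M[K]_(q + n3 + n4, m6 + n2 + n3 + n4 + m5 + m1 + n7) :=
  col3
    (row7 E1 0 0    0    0 0 0)
    (row7 E2 0 1%:M 0    0 0 0)
    (row7 0  0 0    1%:M 0 0 0).

End NoncommutativeMatrices.

Arguments S_A {K} m1 {m2 m3 m4} m5 m6 m7 {n2 n3 n4} n7.
Arguments S_B {K} {m1} m2 m3 m4 m5 m6 m7 {p}.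
Arguments S_C {K} {m1} m2 {m3} m4 m5 m6 m7 {p}.
Arguments S_D {K} m1 m5 {m6} n2 n3 n4 n7 {q}.
Arguments S_E {K} m1 m5 {m6} n2 {n3} n4 n7 {q}.

(* Main.v *)
(* Write W = ker [D; E], U = im [B C] and K = A^-1(U).  The column operations
   X1, ..., X7 and row operations Y1, ..., Y7 are bases adapted to these subspaces.
   Y1 spans AW /\ U and Y5 completes it to a basis of AW; X6 and X5 are preimages
   of Y1 and Y5 in W, and X7 spans W /\ ker A.  Modulo Y1, Y2 and Y3 come from
   im B, Y3 and Y4 come from im C, and Y3 represents im B /\ im C.  Inside
   A^-1(span(Y2, Y3, Y4)), X4 lies in ker D, X2 lies in ker E, and X3 completes
   them modulo X7.  Finally X1 is a complement of K + W; adding to it combinations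
   of X2, X3, X4 puts D X1 and E X1 in canonical form, and Y6 := A X1 stays
   independent of AW + U.  The ranks are then read off from these bases.  Linear
   algebra over the quaternions only needs that they form a division ring, except
   for the invariance of dimension, where the real part of the trace, which
   satisfies Re tr(PQ) = Re tr(QP), replaces a Steinitz exchange argument. *)
Require Import Defs.
From mathcomp Require Import all_boot all_order all_algebra.
From mathcomp Require Import classical_sets reals.
From mathcomp Require Import ring zify.

Set Implicit Arguments.
Unset Strict Implicit.
Unset Printing Implicit Defensive.

Import Order.TTheory GRing.Theory Num.Theory.
Local Open Scope ring_scope.

(** * Quaternions as a division ring, and the real trace *)

Section QuaternionLinearAlgebra.
Variable R : realFieldType.
Local Notation H := (quaternion R).

(** The inverse is the conjugate divided by the squared norm [N], which is nonzero because a sum of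
    squares in an ordered field vanishes only termwise. *)
Lemma quat_inv (x : H) : x != 0 -> exists y : H, y * x = 1.
Proof.
case: x => a b c d x_neq0; set N := a ^+ 2 + b ^+ 2 + c ^+ 2 + d ^+ 2.
have N_neq0 : N != 0.
  apply: contra x_neq0; rewrite /N !paddr_eq0 ?addr_ge0 ?sqr_ge0 // !sqrf_eq0.
  by move=> /andP[/andP[/andP[/eqP-> /eqP->] /eqP->] /eqP->].
exists (Quat (a / N) (- b / N) (- c / N) (- d / N)).
by congr Quat; rewrite /N /=; field.
Qed.

Lemma qreD (x y : H) : qre (x + y) = qre x + qre y.
Proof. by []. Qed.

Lemma qreMC (x y : H) : qre (x * y) = qre (y * x).
Proof. by case: x => ????; case: y => ???? /=; ring. Qed.

(** The quaternion-valued trace is not cyclic; its real part is, because [qre] vanishes on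
    commutators. *)
Definition retr n (M : 'M[H]_n) : R := \sum_i qre (M i i).

Lemma qre_sum (I : finType) (F : I -> H) : qre (\sum_i F i) = \sum_i qre (F i).
Proof. exact: (big_morph _ qreD). Qed.

Lemma retrMC m n (P : 'M[H]_(m, n)) (Q : 'M_(n, m)) :
  retr (P *m Q) = retr (Q *m P).
Proof.
rewrite /retr (eq_bigr (fun i => \sum_j qre (P i j * Q j i))); last first.
  by move=> i _; rewrite mxE qre_sum.
rewrite exchange_big /=; apply: eq_bigr => j _; rewrite mxE qre_sum.
by apply: eq_bigr => i _; rewrite qreMC.
Qed.

Lemma retr1 n : retr (1%:M : 'M[H]_n) = n%:R.
Proof.
rewrite /retr (eq_bigr (fun=> 1)) ?sumr_const ?card_ord // => i _.
by rewrite mxE eqxx.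
Qed.

(** * Independence, extension to bases, preimages and rank *)

Definition left_invertible m n (M : 'M[H]_(m, n)) :=
  exists L, L *m M = 1%:M.

(** Rectangular on purpose: bases are assembled from blocks, so their number of columns is a sum
    that equals the ambient dimension only propositionally. *)
Definition biinvertible m n (M : 'M[H]_(m, n)) :=
  exists L, M *m L = 1%:M /\ L *m M = 1%:M.

(** The two products are identities of sizes [m] and [n] with the same real trace, and natural
    numbers embed in an ordered field. *)
Lemma biinvertible_dim m n (M : 'M[H]_(m, n)) : biinvertible M -> n = m.
Proof.
case=> L [ML LM]; have := retrMC M L; rewrite ML LM !retr1.
by move=> /eqP; rewrite eqr_nat => /eqP.
Qed.

(** Induction on the columns of [M]: a column is added to the family when it is independent of [U]
    and of the columns selected so far. *)
Lemma extend_span m n (M : 'M[H]_(m, n)) a (U : 'M[H]_(m, a)) :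
  left_invertible U ->
  exists d (X : 'M[H]_(n, d)),
    left_invertible (row_mx U (M *m X)) /\
    exists Y Z, M = U *m Y + M *m X *m Z.
Proof.
move=> U_free.
(* The left inverse is carried through the induction as two blocks [L1], [L2], dual to [U] and to
   [M *m X]. *)
suff [d [X [L1 [L2 [L1U L1M L2U [L2M YZ]]]]]] : exists d (X : 'M[H]_(n, d)) L1 L2,
    [/\ L1 *m U = 1%:M, L1 *m (M *m X) = 0, L2 *m U = 0 &
    L2 *m (M *m X) = 1%:M /\ exists Y Z, M = U *m Y + M *m X *m Z].
  exists d, X; split=> //; exists (col_mx L1 L2).
  by rewrite mul_col_row L1U L1M L2U L2M -scalar_mx_block.
elim: n M => [|n IHn] M.
  have [L LU] := U_free; exists 0%N, 0, L, 0; rewrite !mulmx0 mul0mx; split=> //.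
  by split; [apply/matrixP=> -[] | exists 0, 0; apply/matrixP=> ? -[]].
move: M; rewrite -addn1 => M; rewrite -(hsubmxK M).
move: (lsubmx M) (rsubmx M) => {}M v.
have [d [X [L1 [L2 [L1U L1M L2U [L2M [Y [Z MYZ]]]]]]]] := IHn M.
move: {-1}(M *m X) (erefl (M *m X)) => V VE; rewrite VE in L1M L2M MYZ.
(* [J] is the projection that kills [U] and [V]; if [J *m v = 0], the last column [v] is a
   combination of them and is not selected. *)
pose J := 1%:M - U *m L1 - V *m L2.
have JU : J *m U = 0.
  by rewrite !mulmxBl -!mulmxA L1U L2U mul1mx mulmx1 mulmx0 subrr subr0.
have JV : J *m V = 0.
  by rewrite !mulmxBl -!mulmxA L1M L2M mul1mx mulmx1 mulmx0 subr0 subrr.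
have [Jv0|/matrix0Pn[i [j Jv]]] := eqVneq (J *m v) 0.
  exists d, (col_mx X 0), L1, L2; rewrite mul_row_col mulmx0 addr0 VE; split=> //.
  split=> //; exists (row_mx Y (L1 *m v)), (row_mx Z (L2 *m v)).
  rewrite !mul_mx_row add_row_mx -MYZ; congr row_mx.
  move/eqP: Jv0; rewrite !mulmxBl mul1mx -addrA -opprD subr_eq0 => /eqP.
  by rewrite !mulmxA.
have [y yJv] := quat_inv Jv.
(* A row of [J] that is nonzero on [v], rescaled on the left, is a linear form dual to [v] and zero
   on [U] and [V]. Subtracting left multiples of it makes [L1] and [L2] vanish on [v]. *)
pose l : 'rV_m := y%:M *m row i J.
have lU : l *m U = 0 by rewrite -mulmxA -row_mul JU row0 mulmx0.
have lV : l *m V = 0 by rewrite -mulmxA -row_mul JV row0 mulmx0.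
have lv : l *m v = 1%:M.
  rewrite -mulmxA -row_mul; apply/rowP=> k; rewrite mul_scalar_mx mxE mxE [RHS]mxE.
  by rewrite !ord1 eqxx mulr1n -yJv (ord1 j).
exists (d + 1)%N, (block_mx X 0 0 1%:M), (L1 - L1 *m v *m l).
exists (col_mx (L2 - L2 *m v *m l) l).
rewrite mul_row_block !mulmx0 addr0 add0r mulmx1 VE.
have mulL k (L : 'M_(k, m)) n' (W : 'M_(m, n')) :
    (L - L *m v *m l) *m W = L *m W - L *m v *m (l *m W).
  by rewrite mulmxBl -!mulmxA.
split.
- by rewrite mulL lU mulmx0 subr0.
- by rewrite mul_mx_row !mulL L1M lV lv mulmx0 mulmx1 !subrr row_mx0.
- by rewrite mul_col_mx mulL lU L2U mulmx0 subr0 col_mx0.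
split.
  rewrite mul_col_row !mulL lV lv L2M mulmx0 mulmx1 subrr subr0.
  by rewrite -scalar_mx_block.
exists (row_mx Y 0), (block_mx Z 0 0 1%:M).
rewrite mul_mx_row mul_row_block !mulmx0 addr0 add0r mulmx1 add_row_mx add0r.
by rewrite -MYZ.
Qed.

Definition inj_mx m n (M : 'M[H]_(m, n)) := forall x : 'cV[H]_n, M *m x = 0 -> x = 0.

Lemma inj_mx_eq0 m n k (M : 'M[H]_(m, n)) (X : 'M_(n, k)) :
  inj_mx M -> M *m X = 0 -> X = 0.
Proof.
move=> Minj MX; apply/matrixP=> i j.
have /matrixP/(_ i 0) : col j X = 0.
  by apply: Minj; rewrite colE mulmxA MX mul0mx.
by rewrite !mxE.
Qed.

Lemma left_invertible0 m (M : 'M[H]_(m, 0)) : left_invertible M.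
Proof. by exists 0; apply/matrixP=> -[]. Qed.

(** For the converse, extending the empty family gives [M = M *m X *m Z] with [M *m X] left
    invertible; injectivity cancels [M] and yields [X *m Z = 1], so [X] times the left inverse of
    [M *m X] inverts [M]. *)
Lemma left_invertibleP m n (M : 'M[H]_(m, n)) : left_invertible M <-> inj_mx M.
Proof.
split=> [[L LM] x Mx|Minj]; first by rewrite -[x]mul1mx -LM -mulmxA Mx mulmx0.
have [d [X [[L LMX] [Y [Z]]]]] := extend_span M (left_invertible0 (0 : 'M_(m, 0))).
rewrite mul0mx add0r => MXZ.
move: LMX; rewrite -(vsubmxK L) mul_col_row (scalar_mx_block 0 d).
move=> /eq_block_mx[_ _ _ LMX].
exists (X *m dsubmx L).
have XZ : 1%:M - X *m Z = 0.
  by apply: (inj_mx_eq0 Minj); rewrite mulmxBr mulmx1 mulmxA -MXZ subrr.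
rewrite -mulmxA {1}MXZ (mulmxA (dsubmx L)) LMX mul1mx; apply/esym/eqP.
by rewrite -subr_eq0 XZ.
Qed.

Lemma biinvertibleP m n (M : 'M[H]_(m, n)) :
  left_invertible M -> (exists N, 1%:M = M *m N) -> biinvertible M.
Proof.
move=> [L LM] [N MN]; exists L; split=> //.
by rewrite [L](_ : _ = N) // -[N]mul1mx -LM -mulmxA -MN mulmx1.
Qed.

Lemma extend_basis m a (U : 'M[H]_(m, a)) :
  left_invertible U -> exists d (V : 'M[H]_(m, d)), biinvertible (row_mx U V).
Proof.
move=> Ufree; have [d [V [UV [Y [Z YZ]]]]] := extend_span 1%:M Ufree.
rewrite !mul1mx in UV YZ; exists d, V; apply: biinvertibleP => //.
by exists (col_mx Y Z); rewrite mul_row_col.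
Qed.

(* [N] spans the preimage of the column space of [U] under [M]. *)
Lemma split_preimage m n (M : 'M[H]_(m, n)) a (U : 'M[H]_(m, a)) :
  left_invertible U ->
  exists d k (X : 'M[H]_(n, d)) (N : 'M[H]_(n, k)),
    [/\ biinvertible (row_mx X N), left_invertible (row_mx U (M *m X))
      & exists Y, M *m N = U *m Y].
Proof.
move=> Ufree; have [d [X [UMX [Y [Z MYZ]]]]] := extend_span M Ufree.
have [L] := UMX; rewrite -(vsubmxK L) mul_col_row (scalar_mx_block a d).
move: (usubmx L) (dsubmx L) => L1 L2 /eq_block_mx[_ _ L2U L2MX].
have Xfree : left_invertible X by exists (L2 *m M); rewrite -mulmxA.
(* Since [L2] kills [U] and inverts [M *m X], the product [M *m J] equals [U *m Y]: the columns of
   [J] lie in the preimage. Together with [X] they span everything, because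
   [1 = J + X *m L2 *m M]. *)
pose J := 1%:M - X *m L2 *m M.
have [k [W [XJW [Y' [Z' JYZ]]]]] := extend_span J Xfree.
exists d, k, X, (J *m W); split=> //.
  apply: biinvertibleP => //; exists (col_mx (Y' + L2 *m M) Z').
  by rewrite mul_row_col mulmxDr addrAC -JYZ /J mulmxA subrK.
exists (Y *m W); rewrite !mulmxA; congr (_ *m _).
rewrite mulmxBr mulmx1 !mulmxA {1 3}MYZ.
rewrite mulmxDr !(mulmxA _ U) -(mulmxA (M *m X)) L2U mulmx0 mul0mx add0r.
rewrite !mulmxA -(mulmxA (M *m X) L2 M) -(mulmxA (M *m X) _ X) -(mulmxA L2 M X) L2MX mulmx1.
by rewrite addrK.
Qed.

(** Two bases of one column space are related by transition matrices that injectivity makes mutually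
    inverse, so [biinvertible_dim] equates their sizes. *)
Lemma rankP m n d (M : 'M[H]_(m, n)) (F : 'M[H]_(m, d)) :
  left_invertible F -> (exists X, F = M *m X) -> (exists Y, M = F *m Y) ->
  rank M = d.
Proof.
move=> Ffree FM MF.
have basis_F : right_basis (colspace M) F.
  split; first exact/left_invertibleP.
  have [X FX] := FM; have [Y MY] := MF; rewrite /colspace; apply/seteqP.
  split=> _ [x _ <-]; [exists (X *m x)|exists (Y *m x)] => //.
    by rewrite mulmxA FX.
  by rewrite mulmxA -MY.
(* The basis [F] excludes the default value of [xget]; otherwise [V] is the basis behind the chosen
   dimension [e]. *)
rewrite /rank /right_dim; case: xgetP => [e _ [V [Vinj VM]]|/(_ d)[]]; last by exists F.
have [Finj FMs] := basis_F.
have span k l (G : 'M[H]_(m, k)) (G' : 'M[H]_(m, l)) :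
    colspace G = colspace G' -> exists S, G = G' *m S.
  move=> GG'.
  have /fin_all_exists[s sP] (j : 'I_k) : exists x, col j G = G' *m x.
    have : colspace G (col j G) by exists (delta_mx j 0); rewrite // -colE.
    by rewrite GG' => -[x _ <-]; exists x.
  exists (\matrix_(i, j) s j i 0); apply/matrixP=> i j.
  have /matrixP/(_ i 0) := sP j; rewrite !mxE => ->.
  by apply: eq_bigr => t _; rewrite !mxE.
have [S VS] := span _ _ V F (etrans VM (esym FMs)).
have [T FT] := span _ _ F V (etrans FMs (esym VM)).
apply/esym/(@biinvertible_dim _ _ T); exists S; split; apply/eqP.
  rewrite -subr_eq0; apply/eqP/(inj_mx_eq0 Vinj).
  by rewrite mulmxBr mulmx1 mulmxA -FT -VS subrr.
rewrite -subr_eq0; apply/eqP/(inj_mx_eq0 Finj).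
by rewrite mulmxBr mulmx1 mulmxA -VS -FT subrr.
Qed.

(** * Products, permutations and shears of block rows *)

Lemma left_invertible_eq0 m n k (M : 'M[H]_(m, n)) (X : 'M_(n, k)) :
  left_invertible M -> M *m X = 0 -> X = 0.
Proof. by move=> [L LM] MX; rewrite -[X]mul1mx -LM -mulmxA MX mulmx0. Qed.

Lemma biinvertible_left m n (M : 'M[H]_(m, n)) :
  biinvertible M -> left_invertible M.
Proof. by move=> [L []]; exists L. Qed.

Lemma left_invertible_mul m n k (M : 'M[H]_(m, n)) (N : 'M[H]_(n, k)) :
  left_invertible M -> left_invertible N -> left_invertible (M *m N).
Proof.
move=> [L LM] [L' L'N]; exists (L' *m L).
by rewrite mulmxA -(mulmxA L') LM mulmx1.
Qed.

Lemma biinvertible_mul m n k (M : 'M[H]_(m, n)) (N : 'M[H]_(n, k)) :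
  biinvertible M -> biinvertible N -> biinvertible (M *m N).
Proof.
move=> [L [ML LM]] [L' [NL' L'N]]; exists (L' *m L).
by rewrite mulmxA -(mulmxA M) NL' mulmx1 mulmxA -(mulmxA L') LM mulmx1.
Qed.

Lemma biinvertible1 n : biinvertible (1%:M : 'M[H]_n).
Proof. by exists 1%:M; rewrite mulmx1. Qed.

Lemma left_invertible_rowl m a b (U : 'M[H]_(m, a)) (V : 'M[H]_(m, b)) :
  left_invertible (row_mx U V) -> left_invertible U.
Proof.
move=> [L]; rewrite -(vsubmxK L) mul_col_row (scalar_mx_block a b).
by move=> /eq_block_mx[LU _ _ _]; exists (usubmx L).
Qed.

Lemma left_invertible_rowr m a b (U : 'M[H]_(m, a)) (V : 'M[H]_(m, b)) :
  left_invertible (row_mx U V) -> left_invertible V.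
Proof.
move=> [L]; rewrite -(vsubmxK L) mul_col_row (scalar_mx_block a b).
by move=> /eq_block_mx[_ _ _ LV]; exists (dsubmx L).
Qed.

Lemma biinvertible_diag m n m' n' (M : 'M[H]_(m, n)) (N : 'M[H]_(m', n')) :
  biinvertible M -> biinvertible N -> biinvertible (block_mx M 0 0 N).
Proof.
move=> [L [ML LM]] [L' [NL' L'N]]; exists (block_mx L 0 0 L').
rewrite !mulmx_block !mulmx0 !mul0mx !addr0 !add0r ML LM NL' L'N.
by rewrite -!scalar_mx_block.
Qed.

Definition swap_mx a b : 'M[H]_(a + b, b + a) := block_mx 0 1%:M 1%:M 0.

Lemma biinvertible_swap a b : biinvertible (swap_mx a b).
Proof.
exists (swap_mx b a); rewrite /swap_mx !mulmx_block !mulmx0 !mulmx1 !addr0 !add0r.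
by rewrite -!scalar_mx_block.
Qed.

Lemma row_mx_swap m a b (U : 'M[H]_(m, a)) (V : 'M[H]_(m, b)) :
  row_mx U V *m swap_mx a b = row_mx V U.
Proof. by rewrite mul_row_block !mulmx0 !mulmx1 addr0 add0r. Qed.

Lemma left_invertible_rowC m a b (U : 'M[H]_(m, a)) (V : 'M[H]_(m, b)) :
  left_invertible (row_mx U V) -> left_invertible (row_mx V U).
Proof.
rewrite -(row_mx_swap U) => /left_invertible_mul; apply.
exact/biinvertible_left/biinvertible_swap.
Qed.

Lemma biinvertible_rowC m a b (U : 'M[H]_(m, a)) (V : 'M[H]_(m, b)) :
  biinvertible (row_mx U V) -> biinvertible (row_mx V U).
Proof.
by rewrite -(row_mx_swap U) => /biinvertible_mul; apply; exact: biinvertible_swap.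
Qed.

Lemma left_invertible_cast m a b (e : a = b) (U : 'M[H]_(m, a)) :
  left_invertible (castmx (erefl m, e) U) <-> left_invertible U.
Proof. by case: b / e; rewrite castmx_id. Qed.

Lemma biinvertible_cast m a b (e : a = b) (U : 'M[H]_(m, a)) :
  biinvertible (castmx (erefl m, e) U) <-> biinvertible U.
Proof. by case: b / e; rewrite castmx_id. Qed.

Lemma left_invertible_rowA m a b c (U : 'M[H]_(m, a)) (V : 'M[H]_(m, b))
    (W : 'M[H]_(m, c)) :
  left_invertible (row_mx U (row_mx V W)) <->
  left_invertible (row_mx (row_mx U V) W).
Proof. by rewrite row_mxA left_invertible_cast. Qed.

Lemma biinvertible_rowA m a b c (U : 'M[H]_(m, a)) (V : 'M[H]_(m, b))
    (W : 'M[H]_(m, c)) :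
  biinvertible (row_mx U (row_mx V W)) <-> biinvertible (row_mx (row_mx U V) W).
Proof. by rewrite row_mxA biinvertible_cast. Qed.

Lemma row_mx_diag m a b a' b' (U : 'M[H]_(m, a)) (V : 'M[H]_(m, b))
    (S : 'M[H]_(a, a')) (T : 'M[H]_(b, b')) :
  row_mx U V *m block_mx S 0 0 T = row_mx (U *m S) (V *m T).
Proof. by rewrite mul_row_block !mulmx0 addr0 add0r. Qed.

Lemma left_invertible_row_mul m a b a' b' (U : 'M[H]_(m, a)) (V : 'M[H]_(m, b))
    (S : 'M[H]_(a, a')) (T : 'M[H]_(b, b')) :
  left_invertible (row_mx U V) -> biinvertible S -> biinvertible T ->
  left_invertible (row_mx (U *m S) (V *m T)).
Proof.
rewrite -row_mx_diag => UV Sb Tb; apply: (left_invertible_mul UV).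
exact/biinvertible_left/biinvertible_diag.
Qed.

Lemma biinvertible_row_mul m a b a' b' (U : 'M[H]_(m, a)) (V : 'M[H]_(m, b))
    (S : 'M[H]_(a, a')) (T : 'M[H]_(b, b')) :
  biinvertible (row_mx U V) -> biinvertible S -> biinvertible T ->
  biinvertible (row_mx (U *m S) (V *m T)).
Proof.
rewrite -row_mx_diag => UV Sb Tb; apply: (biinvertible_mul UV).
exact: biinvertible_diag.
Qed.

Lemma biinvertible_rowCA m a b c (U : 'M[H]_(m, a)) (V : 'M[H]_(m, b))
    (W : 'M[H]_(m, c)) :
  biinvertible (row_mx U (row_mx V W)) -> biinvertible (row_mx V (row_mx U W)).
Proof.
move=> /biinvertible_rowA UVW; apply/biinvertible_rowA.
rewrite -(row_mx_swap U V) -[W]mulmx1; apply: biinvertible_row_mul => //.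
  exact: biinvertible_swap.
exact: biinvertible1.
Qed.

Lemma left_invertible_rowCA m a b c (U : 'M[H]_(m, a)) (V : 'M[H]_(m, b))
    (W : 'M[H]_(m, c)) :
  left_invertible (row_mx U (row_mx V W)) ->
  left_invertible (row_mx V (row_mx U W)).
Proof.
move=> /left_invertible_rowA UVW; apply/left_invertible_rowA.
rewrite -(row_mx_swap U V) -[W]mulmx1; apply: left_invertible_row_mul => //.
  exact: biinvertible_swap.
exact: biinvertible1.
Qed.

Lemma biinvertible_shear m a b (U : 'M[H]_(m, a)) (V : 'M[H]_(m, b))
    (S : 'M[H]_(b, a)) :
  biinvertible (row_mx U V) -> biinvertible (row_mx (U - V *m S) V).
Proof.
have -> : row_mx (U - V *m S) V = row_mx U V *m block_mx 1%:M 0 (- S) 1%:M.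
  by rewrite mul_row_block !mulmx1 mulmx0 add0r mulmxN.
move=> /biinvertible_mul; apply; exists (block_mx 1%:M 0 S 1%:M).
rewrite !mulmx_block !mulmx0 !mul0mx !mulmx1 !mul1mx !addr0 !add0r addNr addrN.
by rewrite -!scalar_mx_block.
Qed.

(** * Bases adapted to kernels, images and pairs of maps *)

(** The kernel is the preimage of the span of a matrix without columns. *)
Lemma split_kernel m n (M : 'M[H]_(m, n)) :
  exists d k (X : 'M[H]_(n, d)) (N : 'M[H]_(n, k)),
    [/\ biinvertible (row_mx X N), left_invertible (M *m X) & M *m N = 0].
Proof.
have [d [k [X [N [XN MX [Y MN]]]]]] :=
  split_preimage M (left_invertible0 (0 : 'M_(m, 0))).
exists d, k, X, N; split=> //; first exact: left_invertible_rowr MX.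
by rewrite MN mul0mx.
Qed.

(** Everything happens modulo the span of [Y]. Complements [X], [X'] of the preimages of that span
    under [B] and [C] are taken first; the part [T3] of [X'] that [C] sends into the span of [Y] and
    [B *m X] represents the intersection of the two images, and [Z3] gives its coordinates along
    [B *m X]. *)
Lemma column_pair_basis m p1 p2 m1 (B : 'M[H]_(m, p1)) (C : 'M[H]_(m, p2))
    (Y : 'M[H]_(m, m1)) :
  left_invertible Y ->
  exists m2 m3 m4 r1 r2 (b2 : 'M[H]_(p1, m2)) (b3 : 'M[H]_(p1, m3))
      (b1 : 'M[H]_(p1, r1)) (c1 : 'M[H]_(p2, r2)) (c3 : 'M[H]_(p2, m3))
      (c4 : 'M[H]_(p2, m4)) B1 C1 C2,
    [/\ biinvertible (row3 b2 b3 b1), biinvertible (row3 c1 c3 c4),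
        left_invertible (row_mx Y (row3 (B *m b2) (B *m b3) (C *m c4)))
      & [/\ B *m b1 = Y *m B1, C *m c1 = Y *m C1
          & C *m c3 = Y *m C2 + B *m b3]].
Proof.
move=> Yfree.
have [s [r1 [X [b1 [Xb1 YBX [B1 Bb1]]]]]] := split_preimage B Yfree.
have [t [r2 [X' [c1 [Xc1 YCX [C1 Cc1]]]]]] := split_preimage C Yfree.
have [m4 [m3 [T4 [T3 [T43 YBC [Z CT3]]]]]] := split_preimage (C *m X') YBX.
move: CT3; rewrite -(vsubmxK Z) mul_row_col.
move: (usubmx Z) (dsubmx Z) => C2 Z3 CT3.
(* If [Z3 *m z = 0], then [C *m X' *m T3 *m z] lies in the span of [Y], which [YCX] forbids unless
   [T3 *m z = 0]. *)
have Z3free : left_invertible Z3.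
  apply/left_invertibleP=> z Z3z.
  have /(left_invertible_eq0 YCX)/(congr1 dsubmx) :
      row_mx Y (C *m X') *m col_mx (- (C2 *m z)) (T3 *m z) = 0.
    rewrite mul_row_col mulmxN (mulmxA _ T3) CT3 mulmxDl -!mulmxA Z3z !mulmx0.
    by rewrite addr0 addNr.
  rewrite col_mxKd linear0; apply: left_invertible_eq0.
  exact: left_invertible_rowr (biinvertible_left T43).
have [m2 [Z2 Z32]] := extend_basis Z3free.
exists m2, m3, m4, r1, r2, (X *m Z2), (X *m Z3), b1, c1, (X' *m T3), (X' *m T4).
exists B1, C1, C2; split.
- rewrite /row3 -mul_mx_row -(mulmx1 b1).
  by apply: biinvertible_row_mul => //;
    [exact: biinvertible_rowC | exact: biinvertible1].
- apply/biinvertible_rowA; rewrite -mul_mx_row -(mulmx1 c1).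
  by apply: biinvertible_row_mul;
    [exact: biinvertible_rowC | exact: biinvertible1 | exact: biinvertible_rowC].
- rewrite /row3 !mulmxA -mul_mx_row -(mulmx1 (C *m _ *m _)) -row_mx_diag.
  rewrite -(mulmx1 Y); apply: left_invertible_row_mul.
  + exact/left_invertible_rowA.
  + exact: biinvertible1.
  + apply: biinvertible_diag; last exact: biinvertible1.
    exact: biinvertible_rowC.
- by split=> //; rewrite !mulmxA.
Qed.

(** A basis adapted to two subspaces: [x4], [x7] span the kernel of [D], [x2], [x7] that of [E], so
    [x7] spans the intersection and [x3] completes the sum. *)
Lemma kernel_pair_basis k q1 q2 (D : 'M[H]_(q1, k)) (E : 'M[H]_(q2, k)) :
  exists n2 n3 n4 n7 (x2 : 'M[H]_(k, n2)) (x3 : 'M[H]_(k, n3))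
      (x4 : 'M[H]_(k, n4)) (x7 : 'M[H]_(k, n7)),
    [/\ biinvertible (row_mx (row3 x2 x3 x4) x7),
        left_invertible (row_mx (D *m x2) (D *m x3)),
        left_invertible (row_mx (E *m x3) (E *m x4))
      & [/\ D *m x4 = 0, D *m x7 = 0, E *m x2 = 0 & E *m x7 = 0]].
Proof.
have [s [t [X [N [XN DX DN]]]]] := split_kernel D.
have [n4 [n7 [T4 [T7 [T47 ET4 ET7]]]]] := split_kernel (E *m N).
have [n3 [n2 [T3 [T2 [T32 ET3 [Z ET2]]]]]] := split_preimage (E *m X) ET4.
rewrite -!mulmxA in ET4 ET7 ET3 ET2.
(* [E] sends [X *m T2] into the span of [E *m N *m T4]; subtracting [N *m T4 *m Z] moves it into the
   kernel of [E] and leaves its image under [D] unchanged. *)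
exists n2, n3, n4, n7, (X *m T2 - N *m T4 *m Z), (X *m T3), (N *m T4), (N *m T7).
split; last split.
- rewrite /row3; apply/biinvertible_rowA.
  rewrite (_ : row_mx (X *m T2 - N *m T4 *m Z) (X *m T3) =
    X *m row_mx T2 T3 - row_mx (N *m T4) (N *m T7) *m block_mx Z 0 0 0).
    apply: biinvertible_shear; rewrite -mul_mx_row.
    by apply: biinvertible_row_mul => //; exact: biinvertible_rowC.
  by rewrite mul_row_block !mulmx0 !addr0 mul_mx_row opp_row_mx oppr0 add_row_mx addr0.
- rewrite mulmxBr !mulmxA DN !mul0mx subr0 -mul_mx_row.
  by apply: (left_invertible_mul DX); exact/left_invertible_rowC/biinvertible_left.
- exact: left_invertible_rowC.
- by rewrite mulmxA DN mul0mx.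
- by rewrite mulmxA DN mul0mx.
- by rewrite mulmxBr ET2 !mulmxA subrr.
- by [].
Qed.

(** [w7] spans the kernel of [M], [M *m w6] is a basis of the intersection of the images of [M] and
    [G], and [M *m w5] completes it inside the image of [M]. *)
Lemma image_meet_basis m w p (M : 'M[H]_(m, w)) (G : 'M[H]_(m, p)) :
  exists r5 r6 r7 (w5 : 'M[H]_(w, r5)) (w6 : 'M[H]_(w, r6))
      (w7 : 'M[H]_(w, r7)) Y,
    [/\ biinvertible (row3 w5 w6 w7), left_invertible (M *m w6),
        M *m w6 = G *m Y, M *m w7 = 0
      & forall (z : 'cV_r5) (g : 'cV_p), M *m w5 *m z = G *m g -> z = 0].
Proof.
have [d [r7 [X [w7 [Xw MX Mw7]]]]] := split_kernel M.
(* The columns of [G] may be dependent; [G *m S] is a basis of its image. *)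
have [e [S [/left_invertible_rowr GS [Z' [Z GZ]]]]] :=
  extend_span G (left_invertible0 (0 : 'M_(m, 0))).
rewrite mul0mx add0r in GZ.
have [r5 [r6 [T5 [T6 [T56 GT5 [Y MT6]]]]]] := split_preimage (M *m X) GS.
exists r5, r6, r7, (X *m T5), (X *m T6), w7, (S *m Y); split=> //.
- rewrite /row3 -mul_mx_row -(mulmx1 w7).
  by apply: biinvertible_row_mul => //; exact: biinvertible1.
- rewrite mulmxA; apply: (left_invertible_mul MX).
  exact/left_invertible_rowr/biinvertible_left/T56.
- by rewrite !mulmxA.
move=> z g; rewrite GZ => MzG.
have /(left_invertible_eq0 GT5)/(congr1 dsubmx) :
    row_mx (G *m S) (M *m X *m T5) *m col_mx (- (Z *m g)) z = 0.
  by rewrite mul_row_col -(mulmxA M) MzG mulmxN (mulmxA _ Z) addNr.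
by rewrite col_mxKd linear0.
Qed.

(** * Simultaneous bases for the five matrices *)

Lemma row_mx_castl m a a' b (e : a = a') (U : 'M[H]_(m, a)) (V : 'M[H]_(m, b)) :
  row_mx (castmx (erefl m, e) U) V =
  castmx (erefl m, congr1 (addn^~ b) e) (row_mx U V).
Proof. by case: a' / e => /=; rewrite !castmx_id. Qed.

Lemma row_mx_castr m a b b' (e : b = b') (U : 'M[H]_(m, a)) (V : 'M[H]_(m, b)) :
  row_mx U (castmx (erefl m, e) V) =
  castmx (erefl m, congr1 (addn a) e) (row_mx U V).
Proof. by case: b' / e => /=; rewrite !castmx_id. Qed.

(** Rewriting with this tuple left-associates nested block rows and pulls the size casts outside,
    where the cast lemmas for invertibility remove them. *)
Definition row_assocE :=
  (@row_mxA H, @row_mx_castl, @row_mx_castr).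

Lemma col_mx_eq0_inv m1 m2 n (U : 'M[H]_(m1, n)) (V : 'M[H]_(m2, n)) :
  col_mx U V = 0 -> U = 0 /\ V = 0.
Proof. by move/eqP; rewrite col_mx_eq0 => /andP[/eqP-> /eqP->]. Qed.

Lemma biinvertible_row3_span m a b c k (U : 'M[H]_(m, a)) (V : 'M[H]_(m, b))
    (W : 'M[H]_(m, c)) (M : 'M[H]_(m, k)) :
  biinvertible (row3 U V W) ->
  exists x y z, M = U *m x + V *m y + W *m z.
Proof.
move=> [L [UVW _]]; exists (usubmx (usubmx L) *m M), (dsubmx (usubmx L) *m M).
exists (dsubmx L *m M); rewrite !mulmxA -!mulmxDl -!mul_row_col !vsubmxK.
by rewrite -/(row3 U V W) UVW mul1mx.
Qed.

(** The [X] blocks follow the block columns of [S_A], the [Y] blocks its block rows; hence [X1] has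
    [m6] columns and [X6] has [m1]. The conclusion records what both the factorizations and the
    ranks require. *)
Lemma canonical_bases m n p1 p2 q1 q2 (A : 'M[H]_(m, n))
    (B : 'M[H]_(m, p1)) (C : 'M[H]_(m, p2))
    (D : 'M[H]_(q1, n)) (E : 'M[H]_(q2, n)) :
  exists m1 m2 m3 m4 m5 m6 m7 n2 n3 n4 n7 r1 r2 s1 s2,
  exists (X1 : 'M[H]_(n, m6)) (X2 : 'M[H]_(n, n2)) (X3 : 'M[H]_(n, n3))
      (X4 : 'M[H]_(n, n4)) (X5 : 'M[H]_(n, m5)) (X6 : 'M[H]_(n, m1))
      (X7 : 'M[H]_(n, n7)) (Y7 : 'M[H]_(m, m7))
      (b2 : 'M[H]_(p1, m2)) (b3 : 'M[H]_(p1, m3)) (b1 : 'M[H]_(p1, r1))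
      (c1 : 'M[H]_(p2, r2)) (c3 : 'M[H]_(p2, m3)) (c4 : 'M[H]_(p2, m4))
      (d1 : 'M[H]_(q1, s1)) (e1 : 'M[H]_(q2, s2)) S B1 C1 C2 D1 E1 E2,
  let Y1 := A *m X6 in let Y2 := B *m b2 in let Y3 := B *m b3 in
  let Y4 := C *m c4 in let Y5 := A *m X5 in let Y6 := A *m X1 in
  [/\ biinvertible (row7 X1 X2 X3 X4 X5 X6 X7)
    , biinvertible (row7 Y1 Y2 Y3 Y4 Y5 Y6 Y7)
    , biinvertible (row3 b2 b3 b1)
    , biinvertible (row3 c1 c3 c4)
    & biinvertible (row3 (D *m X2) (D *m X3) d1)
      /\ biinvertible (row3 e1 (E *m X3) (E *m X4))] /\
  [/\ left_invertible (col_mx D E *m (row_mx (row3 X1 X2 X3) X4))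
    , A *m row3 X2 X3 X4 = row3 Y2 Y3 Y4 *m S & A *m X7 = 0] /\
  [/\ exists G, Y1 = row_mx B C *m G, B *m b1 = Y1 *m B1, C *m c1 = Y1 *m C1
    & C *m c3 = Y1 *m C2 + Y3] /\
  [/\ D *m X1 = d1 *m D1, D *m X4 = 0, D *m X5 = 0, D *m X6 = 0 & D *m X7 = 0] /\
  [/\ E *m X1 = e1 *m E1 + E *m X3 *m E2, E *m X2 = 0, E *m X5 = 0, E *m X6 = 0
    & E *m X7 = 0].
Proof.
have [dW [w [XW [NW [XNW DEX DEN]]]]] := split_kernel (col_mx D E).
have [DN EN] : D *m NW = 0 /\ E *m NW = 0.
  by apply: col_mx_eq0_inv; rewrite -mul_col_mx; exact: DEN.
(* [NW] spans W; applying the lemma to the restriction of [A] to W and to [[B C]] produces [X5],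
   [X6], [X7]. *)
have [m5 [m1 [n7 [w5 [w6 [w7 [G6 [wb Y1free AX6 AX7 AX5]]]]]]]] :=
  image_meet_basis (A *m NW) (row_mx B C).
rewrite -!mulmxA in Y1free AX6 AX7.
have [T5 [wT5 _]] := wb.
pose X5 := NW *m w5; pose X6 := NW *m w6; pose X7 := NW *m w7.
have NWE : NW = row3 X5 X6 X7 *m T5.
  by rewrite /row3 -!mul_mx_row -mulmxA -/(row3 _ _ _) wT5 mulmx1.
have X57free : left_invertible (row3 X5 X6 X7).
  rewrite /row3 -!mul_mx_row; apply: left_invertible_mul.
    exact: left_invertible_rowr (biinvertible_left XNW).
  exact: biinvertible_left.
have DX57 : D *m row3 X5 X6 X7 = 0 by rewrite /row3 -!mul_mx_row mulmxA DN mul0mx.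
have EX57 : E *m row3 X5 X6 X7 = 0 by rewrite /row3 -!mul_mx_row mulmxA EN mul0mx.
have {}AX5 (z : 'cV_m5) (g : 'cV_(p1 + p2)) : A *m X5 *m z = row_mx B C *m g -> z = 0.
  by rewrite /X5 mulmxA; exact: AX5.
rewrite -/X6 -/X7 in Y1free AX6 AX7.
clearbody X5 X6 X7; clear w5 w6 w7 wb wT5.
have kerDE (x : 'cV_n) : D *m x = 0 -> E *m x = 0 -> exists v, x = row3 X5 X6 X7 *m v.
  move=> Dx Ex; have [L [XNL _]] := XNW.
  have xE : x = XW *m (usubmx L *m x) + NW *m (dsubmx L *m x).
    by rewrite !mulmxA -mulmxDl -mul_row_col vsubmxK XNL mul1mx.
  have : col_mx D E *m XW *m (usubmx L *m x) = 0.
    have : col_mx D E *m x = 0 by rewrite mul_col_mx Dx Ex col_mx0.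
    by rewrite {1}xE mulmxDr !(mulmxA (col_mx D E)) DEN mul0mx addr0.
  move/(left_invertible_eq0 DEX) => xE0; exists (T5 *m (dsubmx L *m x)).
  by rewrite {1}xE xE0 mulmx0 add0r (mulmxA (row3 _ _ _)) -NWE.
have [m2 [m3 [m4 [r1 [r2 [b2 [b3 [b1 [c1 [c3 [c4 [B1 [C1 [C2
  [bb cb Yfree [Bb1 Cc1 Cc3]]]]]]]]]]]]]]]] := column_pair_basis B C Y1free.
set Y234 := row3 _ _ _ in Yfree.
have Y234free := left_invertible_rowr Yfree.
(* [N0] spans the preimage under [A] of the span of [Y234]; [kerY] below gives membership in it. *)
have [d [k [X' [N0 [XN0 YAX [S AN0]]]]]] := split_preimage A Y234free.
have kerY (x : 'cV_n) y : A *m x = Y234 *m y -> exists z, x = N0 *m z.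
  move=> Ax; have [L [XNL _]] := XN0.
  have xE : x = X' *m (usubmx L *m x) + N0 *m (dsubmx L *m x).
    by rewrite !mulmxA -mulmxDl -mul_row_col vsubmxK XNL mul1mx.
  have /(left_invertible_eq0 YAX)/(congr1 dsubmx) : row_mx Y234 (A *m X') *m
     col_mx (S *m (dsubmx L *m x) - y) (usubmx L *m x) = 0.
    rewrite mul_row_col mulmxBr (mulmxA _ S) -AN0 -Ax -!(mulmxA A).
    by rewrite addrAC -mulmxDr (addrC (N0 *m _)) -xE subrr.
  rewrite col_mxKd linear0 => xE0; exists (dsubmx L *m x).
  by rewrite {1}xE xE0 mulmx0 add0r.
have [n2 [n3 [n4 [n7' [x2 [x3 [x4 [x7 [xb Dfree Efree [Dx4 Dx7 Ex2 Ex7]]]]]]]]]] :=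
  kernel_pair_basis (D *m N0) (E *m N0).
rewrite -!mulmxA in Dfree Efree Dx4 Dx7 Ex2 Ex7.
have [T2 [xT2 _]] := xb.
pose X2 := N0 *m x2; pose X3 := N0 *m x3; pose X4 := N0 *m x4.
pose Z7 := N0 *m x7.
have N0E : N0 = row_mx (row3 X2 X3 X4) Z7 *m T2.
  by rewrite /row3 -!mul_mx_row -mulmxA -/(row3 _ _ _) xT2 mulmx1.
have AX24 : A *m row3 X2 X3 X4 = Y234 *m (S *m row3 x2 x3 x4).
  by rewrite mulmxA -AN0 /row3 -!mul_mx_row mulmxA.
rewrite -/X2 -/X3 -/X4 -/Z7 in Dfree Efree Dx4 Dx7 Ex2 Ex7.
clearbody X2 X3 X4 Z7.
(* In a vanishing combination, [D] leaves only the terms in [X2] and [X3]; then [E] isolates [X4],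
   and the rest is a relation among [X5], [X6], [X7]. *)
have X27free : left_invertible (row_mx (row3 X2 X3 X4) (row3 X5 X6 X7)).
  apply/left_invertibleP=> z; rewrite -(vsubmxK z) mul_row_col.
  move: (usubmx z) (dsubmx z) => {z} u v.
  rewrite -(vsubmxK u) mul_row_col -[usubmx u]vsubmxK mul_row_col.
  move: (usubmx (usubmx u)) (dsubmx (usubmx u)) (dsubmx u) => {u} u2 u3 u4 uv0.
  have /(left_invertible_eq0 Dfree) :
      row_mx (D *m X2) (D *m X3) *m col_mx u2 u3 = 0.
    have := congr1 (mulmx D) uv0; rewrite !mulmxDr !mulmxA DX57 Dx4.
    by rewrite !mul0mx mulmx0 !addr0 -mul_row_col.
  move/col_mx_eq0_inv=> [u20 u30].
  move: uv0; rewrite u20 u30 !mulmx0 !add0r => uv0.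
  have /(left_invertible_eq0 Efree)/(congr1 dsubmx) :
      row_mx (E *m X3) (E *m X4) *m col_mx 0 u4 = 0.
    have := congr1 (mulmx E) uv0; rewrite mulmxDr !mulmxA EX57 mul0mx addr0.
    by rewrite mul_row_col !mulmx0 add0r.
  rewrite col_mxKd linear0 => u40.
  move: uv0; rewrite u40 mulmx0 add0r => /(left_invertible_eq0 X57free) ->.
  by rewrite !col_mx0.
have [m6 [X1' X1'b]] := extend_basis X27free.
have [s1 [d1 d1b]] := extend_basis Dfree.
have [s2 [e1 e1b]] := extend_basis Efree.
have [a [b [D1 DX1']]] := biinvertible_row3_span (D *m X1') d1b.
have [b' [c [E1 EX1']]] := biinvertible_row3_span (E *m X1') e1b.
(* Subtracting [X2 *m a + X3 *m b] clears the first two components of [D *m X1'], and [X4 *m c]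
   clears the last of [E *m X1'] without affecting [D]. The component along [E *m X3] becomes
   [b' - b], which is the final [E2]. *)
have [X1 [X1E X1b]] : exists X1, X1 = X1' - (X2 *m a + X3 *m b + X4 *m c) /\
    biinvertible (row_mx X1 (row_mx (row3 X2 X3 X4) (row3 X5 X6 X7))).
  exists (X1' - (X2 *m a + X3 *m b + X4 *m c)); split=> //.
  rewrite (_ : _ + X4 *m c = row_mx (row3 X2 X3 X4) (row3 X5 X6 X7) *m
      col_mx (col3 a b c) 0); first exact/biinvertible_shear/biinvertible_rowC.
  by rewrite mul_row_col mulmx0 addr0 /col3 !mul_row_col.
have DX1 : D *m X1 = d1 *m D1.
  rewrite X1E mulmxBr DX1' !mulmxDr !mulmxA Dx4 mul0mx addr0.
  by rewrite addrAC subrr add0r.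
have EX1 : E *m X1 = e1 *m E1 + E *m X3 *m (b' - b).
  rewrite X1E mulmxBr EX1' !mulmxDr !mulmxA Ex2 mul0mx add0r mulmxN.
  rewrite (addrC _ (e1 *m E1)) -addrA; congr (_ + _).
  by rewrite opprD addrACA subrr addr0.
clear X1E X1' X1'b DX1' EX1'.
have Y14free : left_invertible
    (row_mx (row_mx (row_mx (A *m X6) Y234) (A *m X5)) (A *m X1)).
  apply/left_invertibleP=> z; rewrite -(vsubmxK z) mul_row_col.
  rewrite -(vsubmxK (usubmx z)) mul_row_col -[usubmx (usubmx z)]vsubmxK mul_row_col.
  move: (usubmx (usubmx (usubmx z))) (dsubmx (usubmx (usubmx z))).
  move: (dsubmx (usubmx z)) (dsubmx z) => {z} u5 u6 u1 u2 u0.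
  (* The relation puts [X6 *m u1 + X5 *m u5 + X1 *m u6] in the span of [N0], that is, of [X2], [X3],
     [X4] and [Z7]. As [Z7] is killed by [D] and [E], it lies in W, so independence of [X1] from the
     other [X] blocks gives the claim. *)
  have u60 : u6 = 0.
    have [t0 xt0] : exists t, X6 *m u1 + X5 *m u5 + X1 *m u6 = N0 *m t.
      apply: (kerY _ (- u2)); rewrite !mulmxDr !mulmxA mulmxN.
      by apply/eqP; rewrite -subr_eq0 opprK -u0; apply/eqP; rewrite addrAC (addrAC _ _ (Y234 *m _)).
    rewrite N0E -mulmxA -(vsubmxK (T2 *m t0)) mul_row_col in xt0.
    move: (usubmx _) (dsubmx _) xt0 => {t0} t t'.
    have [v ->] : exists v, Z7 *m t' = row3 X5 X6 X7 *m v.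
      by apply: kerDE; rewrite mulmxA ?Dx7 ?Ex7 mul0mx.
    move=> xE.
    have /(left_invertible_eq0 (biinvertible_left X1b))/(congr1 usubmx) :
      row_mx X1 (row_mx (row3 X2 X3 X4) (row3 X5 X6 X7)) *m
      col_mx u6 (- col_mx t (v - col3 u5 u1 0)) = 0.
      rewrite mul_row_col mulmxN mul_row_col mulmxBr addrA -xE.
      rewrite /col3 !mul_row_col mulmx0 addr0.
      by rewrite (addrC (X6 *m _)) [_ + X1 *m u6]addrC addrK subrr.
    by rewrite col_mxKu linear0.
  move: u0; rewrite u60 mulmx0 addr0 => u0.
  (* The remaining terms write [A *m X5 *m u5] as a combination of the columns of [[B C]]; [G6]
     supplies the coefficients of [A *m X6]. *)
  have u50 : u5 = 0.
    apply: (AX5 _ (- (G6 *m u1 + row3 (col_mx b2 0) (col_mx b3 0) (col_mx 0 c4) *m u2))).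
    rewrite mulmxN mulmxDr !mulmxA -AX6 /row3 !mul_mx_row !mul_row_col !mulmx0 addr0.
    by rewrite addr0 add0r; apply/eqP; rewrite -addr_eq0 addrC u0.
  move: u0; rewrite u50 mulmx0 addr0 -mul_row_col => /(left_invertible_eq0 Yfree) ->.
  by rewrite !col_mx0.
have [m7 [Y7 Yb]] := extend_basis Y14free.
exists m1, m2, m3, m4, m5, m6, m7, n2, n3, n4, n7, r1, r2, s1, s2.
exists X1, X2, X3, X4, X5, X6, X7, Y7, b2, b3, b1, c1, c3, c4, d1, e1.
exists (S *m row3 x2 x3 x4), B1, C1, C2, D1, E1, (b' - b) => /=.
have Xb : biinvertible (row7 X1 X2 X3 X4 X5 X6 X7).
  by move: X1b; rewrite /row7 /row3 !row_assocE !biinvertible_cast.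
have [DX5 DX6 DX7] : [/\ D *m X5 = 0, D *m X6 = 0 & D *m X7 = 0].
  move/eqP: DX57; rewrite /row3 !mul_mx_row !row_mx_eq0.
  by move=> /andP[/andP[/eqP-> /eqP->] /eqP->].
have [EX5 EX6 EX7] : [/\ E *m X5 = 0, E *m X6 = 0 & E *m X7 = 0].
  move/eqP: EX57; rewrite /row3 !mul_mx_row !row_mx_eq0.
  by move=> /andP[/andP[/eqP-> /eqP->] /eqP->].
split; last split; last split; last by [].
- split=> //; last split=> //.
  + move: Yb; rewrite /Y234 /row7 /row3 !row_assocE !biinvertible_cast; exact.
  + by apply/biinvertible_rowA/biinvertible_rowC.
(* A combination of [X1] to [X4] killed by [D] and [E] lies in W, the span of the complementary
   blocks. *)
- split=> //; apply/left_invertibleP=> z; rewrite -mulmxA mul_col_mx.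
  move=> /col_mx_eq0_inv[Dz Ez]; have [v] := kerDE _ Dz Ez.
  move/eqP; rewrite -subr_eq0 => /eqP; set XX := row_mx _ X4 => XXv.
  have : left_invertible (row_mx XX (row3 X5 X6 X7)).
    move: (biinvertible_left Xb).
    by rewrite /XX /row7 /row3 !row_assocE !left_invertible_cast.
  have : row_mx XX (row3 X5 X6 X7) *m col_mx z (- v) = 0.
    by rewrite mul_row_col mulmxN.
  move=> zv /left_invertible_eq0/(_ zv)/(congr1 usubmx).
  by rewrite col_mxKu linear0.
by split=> //; exists G6.
Qed.

(** * Ranks of bordered block matrices *)

Lemma left_invertible_block_upper m1 m2 n1 n2 (F : 'M[H]_(m1, n1))
    (V : 'M[H]_(m2, n2)) X :
  left_invertible F -> left_invertible V -> left_invertible (block_mx F X 0 V).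
Proof.
move=> [L LF] [L' L'V]; exists (block_mx L (- (L *m X *m L')) 0 L').
rewrite mulmx_block !mulmx0 !mul0mx !addr0 !add0r LF L'V mulNmx.
by rewrite -(mulmxA _ L') L'V mulmx1 addrN -scalar_mx_block.
Qed.

Lemma left_invertible_block_lower m1 m2 n1 n2 (F : 'M[H]_(m1, n1))
    (V : 'M[H]_(m2, n2)) X :
  left_invertible F -> left_invertible V -> left_invertible (block_mx F 0 X V).
Proof.
move=> [L LF] [L' L'V]; exists (block_mx L 0 (- (L' *m X *m L)) L').
rewrite mulmx_block !mulmx0 !mul0mx !addr0 !add0r LF L'V mulNmx.
by rewrite -(mulmxA _ L) LF mulmx1 addNr -scalar_mx_block.
Qed.

Definition col_sub m a b (F : 'M[H]_(m, a)) (M : 'M[H]_(m, b)) :=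
  exists X, F = M *m X.

Lemma col_sub_refl m a (F : 'M[H]_(m, a)) : col_sub F F.
Proof. by exists 1%:M; rewrite mulmx1. Qed.

Lemma col_sub0 m a b (F : 'M[H]_(m, a)) : col_sub (0 : 'M_(m, b)) F.
Proof. by exists 0; rewrite mulmx0. Qed.

Lemma col_sub_trans m a b c (F : 'M[H]_(m, a)) (G : 'M[H]_(m, b))
    (K : 'M[H]_(m, c)) : col_sub F G -> col_sub G K -> col_sub F K.
Proof. by move=> [X ->] [Y ->]; exists (Y *m X); rewrite mulmxA. Qed.

Lemma col_sub_row m a b c (F : 'M[H]_(m, a)) (G : 'M[H]_(m, b))
    (K : 'M[H]_(m, c)) : col_sub F K -> col_sub G K -> col_sub (row_mx F G) K.
Proof. by move=> [X ->] [Y ->]; exists (row_mx X Y); rewrite mul_mx_row. Qed.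

Lemma col_sub_inl m a b c (F : 'M[H]_(m, a)) (G : 'M[H]_(m, b))
    (K : 'M[H]_(m, c)) : col_sub F G -> col_sub F (row_mx G K).
Proof.
by move=> [X ->]; exists (col_mx X 0); rewrite mul_row_col mulmx0 addr0.
Qed.

Lemma col_sub_inr m a b c (F : 'M[H]_(m, a)) (G : 'M[H]_(m, b))
    (K : 'M[H]_(m, c)) : col_sub F K -> col_sub F (row_mx G K).
Proof.
by move=> [X ->]; exists (col_mx 0 X); rewrite mul_row_col mulmx0 add0r.
Qed.

Lemma col_sub_mul m a b c (F : 'M[H]_(m, a)) (X : 'M[H]_(a, b))
    (K : 'M[H]_(m, c)) : col_sub F K -> col_sub (F *m X) K.
Proof. by move=> [Y ->]; exists (Y *m X); rewrite mulmxA. Qed.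

Lemma col_sub_add m a b (F G : 'M[H]_(m, a)) (K : 'M[H]_(m, b)) :
  col_sub F K -> col_sub G K -> col_sub (F + G) K.
Proof. by move=> [X ->] [Y ->]; exists (X + Y); rewrite mulmxDr. Qed.

Definition column_basis m n d (M : 'M[H]_(m, n)) (F : 'M[H]_(m, d)) :=
  [/\ left_invertible F, col_sub F M & col_sub M F].

Lemma rank_basis m n d (M : 'M[H]_(m, n)) (F : 'M[H]_(m, d)) :
  column_basis M F -> rank M = d.
Proof. by case; exact: rankP. Qed.

Lemma rank_cast m n m' n' (e : (m = m') * (n = n')) (M : 'M[H]_(m, n)) :
  rank (castmx e M) = rank M.
Proof. by case: e; case: m' /; case: n' / => /=; rewrite castmx_id. Qed.

Lemma rank_colA m1 m2 m3 n (U : 'M[H]_(m1, n)) (V : 'M[H]_(m2, n))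
    (W : 'M[H]_(m3, n)) :
  rank (col3 U V W) = rank (col_mx U (col_mx V W)).
Proof. by rewrite col_mxA rank_cast. Qed.

(** Lets a stacked matrix be treated as a bordered block matrix with an empty block column. *)
Lemma rank_row0 m n (U : 'M[H]_(m, n)) : rank (row_mx U (0 : 'M_(m, 0))) = rank U.
Proof.
rewrite -(rank_cast (erefl m, esym (addn0 n)) U); congr rank.
apply/matrixP=> i j; rewrite castmxE mxE cast_ord_id /=.
by case: split_ordP => [k ->|[]//]; congr (U i _); exact/val_inj.
Qed.

Lemma rank_row_preimage m n p f r k (A : 'M[H]_(m, n)) (B : 'M[H]_(m, p))
    (X : 'M[H]_(n, r)) (N : 'M[H]_(n, k)) (F : 'M[H]_(m, f)) :
  biinvertible (row_mx X N) -> column_basis B F ->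
  left_invertible (row_mx F (A *m X)) -> col_sub (A *m N) F ->
  rank (row_mx A B) = (f + r)%N.
Proof.
move=> [L [XNL _]] [_ FB BF] FAX AN.
apply: (@rank_basis _ _ _ _ (row_mx F (A *m X))); split=> //.
  apply: col_sub_row; first exact: col_sub_inr.
  exact/col_sub_inl/col_sub_mul/col_sub_refl.
apply: col_sub_row; last exact: col_sub_inl.
rewrite -[A in col_sub A _]mulmx1 -XNL mulmxA; apply: col_sub_mul.
rewrite mul_mx_row; apply: col_sub_row; last exact: col_sub_inl.
exact/col_sub_inr/col_sub_refl.
Qed.

(** [N] spans the preimage under [A] of the image of [B]. On it the top component can be cancelled
    by columns of [B], so the border contributes exactly the rank of [L *m N]. *)
Lemma rank_block_preimage m n p q f r k g (A : 'M[H]_(m, n)) (B : 'M[H]_(m, p))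
    (L : 'M[H]_(q, n)) (X : 'M[H]_(n, r)) (N : 'M[H]_(n, k))
    (F : 'M[H]_(m, f)) (V : 'M[H]_(q, g)) :
  biinvertible (row_mx X N) -> column_basis B F ->
  left_invertible (row_mx F (A *m X)) -> col_sub (A *m N) F ->
  column_basis (L *m N) V ->
  rank (block_mx A B L 0) = (f + r + g)%N.
Proof.
move=> [Q [XNQ _]] [_ [Z FB] [Y BF]] FAX [T AN] [Vfree [Z' VLN] [Y' LNV]].
apply: (rankP (F := block_mx (row_mx F (A *m X)) 0 (row_mx 0 (L *m X)) V)).
- exact: left_invertible_block_lower.
(* The corner [- (Z *m T *m Z')] cancels [A *m N *m Z'], which equals [B *m Z *m T *m Z']. *)
- exists (block_mx (row_mx 0 X) (N *m Z') (row_mx Z 0) (- (Z *m T *m Z'))).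
  rewrite mulmx_block !mul_mx_row add_row_mx !mulmx0 !mul0mx !addr0 !add0r mulmxN.
  by rewrite !mulmxA -FB AN subrr -VLN row_mx0 addr0.
exists (block_mx (col_mx (T *m dsubmx Q) (usubmx Q)) (col_mx Y 0)
  (Y' *m dsubmx Q) 0).
rewrite mulmx_block !mul_row_col !mulmx0 !mul0mx !addr0 !add0r !mulmxA.
rewrite -AN -LNV -BF addrC -!(mulmxA A) -!(mulmxA L) -!mulmxDr.
by rewrite -mul_row_col vsubmxK XNQ !mulmx1.
Qed.

(** [N] spans the kernel of [L]: the [r] columns of [X] account for the rank of [L], and the rest is
    the rank of [[A *m N, B]]. *)
Lemma rank_block_kernel m n p q f r k (A : 'M[H]_(m, n)) (B : 'M[H]_(m, p))
    (L : 'M[H]_(q, n)) (X : 'M[H]_(n, r)) (N : 'M[H]_(n, k))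
    (F : 'M[H]_(m, f)) :
  biinvertible (row_mx X N) -> L *m N = 0 -> left_invertible (L *m X) ->
  column_basis (row_mx (A *m N) B) F ->
  rank (block_mx A B L 0) = (f + r)%N.
Proof.
move=> [Q [XNQ _]] LN LX [Ffree [Z FZ] [Y YF]].
apply: (rankP (F := block_mx F (A *m X) 0 (L *m X))).
- exact: left_invertible_block_upper.
- exists (block_mx (N *m usubmx Z) X (dsubmx Z) 0).
  rewrite mulmx_block !mulmx0 !mul0mx !addr0 !mulmxA -mul_row_col vsubmxK -FZ LN.
  by rewrite mul0mx.
exists (block_mx (lsubmx Y *m dsubmx Q) (rsubmx Y) (usubmx Q) 0).
move: YF; rewrite -{1}(hsubmxK Y) mul_mx_row => /eq_row_mx[AN BF].
rewrite mulmx_block !mulmx0 !mul0mx !addr0 add0r !mulmxA -AN -BF addrC.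
rewrite -!(mulmxA A) -!mulmxDr -mul_row_col vsubmxK XNQ mulmx1.
rewrite -[L in LHS]mulmx1 -XNQ mulmxA mul_mx_row LN -{1}(vsubmxK Q) mul_row_col.
by rewrite mul0mx addr0.
Qed.

Lemma rank_row3 m a b c (A : 'M[H]_(m, a)) (B : 'M[H]_(m, b)) (C : 'M[H]_(m, c)) :
  rank (row3 A B C) = rank (row_mx A (row_mx B C)).
Proof. by rewrite row_mxA rank_cast. Qed.

Lemma col_mx_cast m1 m2 n n' (e : n = n') (U : 'M[H]_(m1, n)) (V : 'M[H]_(m2, n)) :
  col_mx (castmx (erefl, e) U) (castmx (erefl, e) V) = castmx (erefl, e) (col_mx U V).
Proof. by case: n' / e; rewrite !castmx_id. Qed.

Lemma rank_row3_block m q a b c (A : 'M[H]_(m, a)) (B : 'M[H]_(m, b))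
    (C : 'M[H]_(m, c)) (L : 'M[H]_(q, a)) :
  rank (col_mx (row3 A B C) (row3 L 0 0)) = rank (block_mx A (row_mx B C) L 0).
Proof.
by rewrite /block_mx -[in RHS]row_mx0 !row_mxA col_mx_cast rank_cast.
Qed.

Lemma col_mx_row0 q1 q2 n p (D : 'M[H]_(q1, n)) (E : 'M[H]_(q2, n)) :
  col_mx (row_mx D (0 : 'M_(q1, p))) (row_mx E 0) = row_mx (col_mx D E) 0.
Proof. by rewrite -/(block_mx D 0 E 0) block_mxEh col_mx0. Qed.

(** * Size casts and block products for the factorizations *)

Lemma biinvertible_nonsingular a a' (e : a' = a) (P : 'M[H]_(a, a')) :
  biinvertible P -> nonsingular (castmx (erefl a, e) P).
Proof. by case: a / e P => P; rewrite castmx_id. Qed.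

Lemma biinvertible_nonsingular_inv a a' (e : a' = a) (P : 'M[H]_(a, a')) L :
  P *m L = 1%:M -> L *m P = 1%:M -> nonsingular (castmx (e, erefl a) L).
Proof. by case: a / e P L => P L PL LP; rewrite castmx_id; exists P. Qed.

Lemma cast_factorization a b a' b' (ea : a' = a) (eb : b' = b) (M : 'M[H]_(a, b))
    (P : 'M[H]_(a, a')) (S : 'M[H]_(a', b')) (X : 'M[H]_(b, b')) L :
  M *m X = P *m S -> X *m L = 1%:M ->
  M = castmx (erefl a, ea) P *m castmx (ea, eb) S *m castmx (eb, erefl b) L.
Proof.
move=> MX XL; case: a / ea M P MX => M P MX; case: b / eb M X L MX XL => M X L MX XL.
by rewrite !castmx_id -MX -mulmxA XL mulmx1.
Qed.

Lemma mul_mx_row3 m n c1 c2 c3 (M : 'M[H]_(m, n)) (X1 : 'M[H]_(n, c1))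
    (X2 : 'M[H]_(n, c2)) (X3 : 'M[H]_(n, c3)) :
  M *m row3 X1 X2 X3 = row3 (M *m X1) (M *m X2) (M *m X3).
Proof. by rewrite /row3 !mul_mx_row. Qed.

Lemma mul_mx_row7 m n c1 c2 c3 c4 c5 c6 c7 (M : 'M[H]_(m, n))
    (X1 : 'M[H]_(n, c1)) (X2 : 'M[H]_(n, c2)) (X3 : 'M[H]_(n, c3))
    (X4 : 'M[H]_(n, c4)) (X5 : 'M[H]_(n, c5)) (X6 : 'M[H]_(n, c6))
    (X7 : 'M[H]_(n, c7)) :
  M *m row7 X1 X2 X3 X4 X5 X6 X7 =
  row7 (M *m X1) (M *m X2) (M *m X3) (M *m X4) (M *m X5) (M *m X6) (M *m X7).
Proof. by rewrite /row7 /row3 !mul_mx_row. Qed.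

Lemma mul_row3_col3 m n c1 c2 c3 (X1 : 'M[H]_(m, c1)) (X2 : 'M[H]_(m, c2))
    (X3 : 'M[H]_(m, c3)) (Z1 : 'M[H]_(c1, n)) (Z2 : 'M[H]_(c2, n))
    (Z3 : 'M[H]_(c3, n)) :
  row3 X1 X2 X3 *m col3 Z1 Z2 Z3 = X1 *m Z1 + X2 *m Z2 + X3 *m Z3.
Proof. by rewrite /row3 /col3 !mul_row_col. Qed.

Lemma mul_row7_col7 m n c1 c2 c3 c4 c5 c6 c7
    (X1 : 'M[H]_(m, c1)) (X2 : 'M[H]_(m, c2)) (X3 : 'M[H]_(m, c3))
    (X4 : 'M[H]_(m, c4)) (X5 : 'M[H]_(m, c5)) (X6 : 'M[H]_(m, c6))
    (X7 : 'M[H]_(m, c7)) (Z1 : 'M[H]_(c1, n)) (Z2 : 'M[H]_(c2, n))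
    (Z3 : 'M[H]_(c3, n)) (Z4 : 'M[H]_(c4, n)) (Z5 : 'M[H]_(c5, n))
    (Z6 : 'M[H]_(c6, n)) (Z7 : 'M[H]_(c7, n)) :
  row7 X1 X2 X3 X4 X5 X6 X7 *m col7 Z1 Z2 Z3 Z4 Z5 Z6 Z7 =
  X1 *m Z1 + X2 *m Z2 + X3 *m Z3 + X4 *m Z4 + X5 *m Z5 + X6 *m Z6 + X7 *m Z7.
Proof. by rewrite /row7 /row3 /col7 /col3 !mul_row_col. Qed.

Lemma add_row3 m c1 c2 c3 (X1 Z1 : 'M[H]_(m, c1)) (X2 Z2 : 'M[H]_(m, c2))
    (X3 Z3 : 'M[H]_(m, c3)) :
  row3 X1 X2 X3 + row3 Z1 Z2 Z3 = row3 (X1 + Z1) (X2 + Z2) (X3 + Z3).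
Proof. by rewrite /row3 !add_row_mx. Qed.

Lemma add_row7 m c1 c2 c3 c4 c5 c6 c7 (X1 Z1 : 'M[H]_(m, c1))
    (X2 Z2 : 'M[H]_(m, c2)) (X3 Z3 : 'M[H]_(m, c3)) (X4 Z4 : 'M[H]_(m, c4))
    (X5 Z5 : 'M[H]_(m, c5)) (X6 Z6 : 'M[H]_(m, c6)) (X7 Z7 : 'M[H]_(m, c7)) :
  row7 X1 X2 X3 X4 X5 X6 X7 + row7 Z1 Z2 Z3 Z4 Z5 Z6 Z7 =
  row7 (X1 + Z1) (X2 + Z2) (X3 + Z3) (X4 + Z4) (X5 + Z5) (X6 + Z6) (X7 + Z7).
Proof. by rewrite /row7 /row3 !add_row_mx. Qed.

Lemma mx33_blocks a1 a2 a3 b1 b2 b3 (S : 'M[H]_(a1 + a2 + a3, b1 + b2 + b3)) :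
  exists S11 S12 S13 S21 S22 S23 S31 S32 S33,
    S = col3 (row3 S11 S12 S13) (row3 S21 S22 S23) (row3 S31 S32 S33).
Proof.
have cut3 m (M : 'M[H]_(m, b1 + b2 + b3)) : exists M1 M2 M3, M = row3 M1 M2 M3.
  exists (lsubmx (lsubmx M)), (rsubmx (lsubmx M)), (rsubmx M).
  by rewrite /row3 !hsubmxK.
have [S11 [S12 [S13 S1]]] := cut3 _ (usubmx (usubmx S)).
have [S21 [S22 [S23 S2]]] := cut3 _ (dsubmx (usubmx S)).
have [S31 [S32 [S33 S3]]] := cut3 _ (dsubmx S).
exists S11, S12, S13, S21, S22, S23, S31, S32, S33.
by rewrite -S1 -S2 -S3 /col3 !vsubmxK.
Qed.

End QuaternionLinearAlgebra.

(** * The rank formulas and the canonical forms *)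

Ltac col_sub_tac :=
  first [ done | exact: col_sub0 | exact: col_sub_refl
        | (apply: col_sub_row; col_sub_tac)
        | (apply: col_sub_inl; col_sub_tac)
        | (apply: col_sub_inr; col_sub_tac)
        | (apply: col_sub_mul; col_sub_tac)
        | (apply: col_sub_add; col_sub_tac)].

Ltac solve_col_sub BY CY Y3C :=
  do ?apply: col_sub_row;
  first [ col_sub_tac | apply: (col_sub_trans BY); col_sub_tac
        | apply: (col_sub_trans CY); col_sub_tac
        | apply: (col_sub_trans Y3C); col_sub_tac ].

Theorem theorem2p1 (R : realType) (m n p1 p2 q1 q2 : nat)
    (A : 'M[quaternion R]_(m, n))
    (B : 'M[quaternion R]_(m, p1)) (C : 'M[quaternion R]_(m, p2))
    (D : 'M[quaternion R]_(q1, n)) (E : 'M[quaternion R]_(q2, n)) :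
  let rABC := rank (row3 A B C) in
  let rADE := rank (col3 A D E) in
  let rABCDE := rank (col3 (row3 A B C) (row3 D 0 0) (row3 E 0 0)) in
  let rACDE := rank (col3 (row_mx A C) (row_mx D 0) (row_mx E 0)) in
  let rABDE := rank (col3 (row_mx A B) (row_mx D 0) (row_mx E 0)) in
  let rABCE := rank (col_mx (row3 A B C) (row3 E 0 0)) in
  let rABCD := rank (col_mx (row3 A B C) (row3 D 0 0)) in
  exists m1 m2 m3 m4 m5 m6 n2 n3 n4 : nat,
  [/\ (m1%:Z + m5%:Z + m6%:Z = rABC%:Z + rADE%:Z - rABCDE%:Z)
    , (m2%:Z = rABCDE%:Z - rACDE%:Z)
    , (m4%:Z = rABCDE%:Z - rABDE%:Z)
    & (m3%:Z = rABDE%:Z + rACDE%:Z - rABCDE%:Z - rADE%:Z)] /\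
  [/\ (n2%:Z = rABCDE%:Z - rABCE%:Z)
    , (n4%:Z = rABCDE%:Z - rABCD%:Z)
    & (n3%:Z = rABCD%:Z + rABCE%:Z - rABCDE%:Z - rABC%:Z)] /\
  let m7 := (m - (m1 + m2 + m3 + m4 + m5 + m6))%N in
  let n7 := (n - (m1 + m5 + m6 + n2 + n3 + n4))%N in
  (* the block sizes add up to the dimensions of A, B, C, D, E *)
  exists (em : (m1 + m2 + m3 + m4 + m5 + m6 + m7)%N = m)
         (en : (m6 + n2 + n3 + n4 + m5 + m1 + n7)%N = n)
         (ep1 : (m2 + m3 + (p1 - m2 - m3))%N = p1)
         (ep2 : ((p2 - m3 - m4) + m3 + m4)%N = p2)
         (eq1 : (n2 + n3 + (q1 - n2 - n3))%N = q1)
         (eq2 : ((q2 - n3 - n4) + n3 + n4)%N = q2),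
  exists (A1 : 'M[quaternion R]_(m2, n2)) (A2 : 'M[quaternion R]_(m2, n3))
         (A3 : 'M[quaternion R]_(m2, n4)) (A4 : 'M[quaternion R]_(m3, n2))
         (A5 : 'M[quaternion R]_(m3, n3)) (A6 : 'M[quaternion R]_(m3, n4))
         (A7 : 'M[quaternion R]_(m4, n2)) (A8 : 'M[quaternion R]_(m4, n3))
         (A9 : 'M[quaternion R]_(m4, n4))
         (B1 : 'M[quaternion R]_(m1, p1 - m2 - m3))
         (C1 : 'M[quaternion R]_(m1, p2 - m3 - m4))
         (C2 : 'M[quaternion R]_(m1, m3))
         (D1 : 'M[quaternion R]_(q1 - n2 - n3, m6))
         (E1 : 'M[quaternion R]_(q2 - n3 - n4, m6))
         (E2 : 'M[quaternion R]_(n3, m6)),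
  exists (P : 'M[quaternion R]_m) (Q : 'M[quaternion R]_n)
         (T1 : 'M[quaternion R]_p1) (T2 : 'M[quaternion R]_p2)
         (V1 : 'M[quaternion R]_q1) (V2 : 'M[quaternion R]_q2),
  (nonsingular P /\ nonsingular Q /\ nonsingular T1 /\
   nonsingular T2 /\ nonsingular V1 /\ nonsingular V2) /\
  [/\ A = P *m castmx (em, en)
                (S_A m1 m5 m6 m7 n7 A1 A2 A3 A4 A5 A6 A7 A8 A9) *m Q,
      B = P *m castmx (em, ep1) (S_B m2 m3 m4 m5 m6 m7 B1) *m T1,
      C = P *m castmx (em, ep2) (S_C m2 m4 m5 m6 m7 C1 C2) *m T2,
      D = V1 *m castmx (eq1, en) (S_D m1 m5 n2 n3 n4 n7 D1) *m Q
    & E = V2 *m castmx (eq2, en) (S_E m1 m5 n2 n4 n7 E1 E2) *m Q].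
Proof.
have [m1 [m2 [m3 [m4 [m5 [m6 [m7 [n2 [n3 [n4 [n7 [r1 [r2 [s1 [s2
  [X1 [X2 [X3 [X4 [X5 [X6 [X7 [Y7 [b2 [b3 [b1 [c1 [c3 [c4 [d1 [e1
  [S [B1 [C1 [C2 [D1 [E1 [E2 []]]]]]]]]]]]]]]]]]]]]]]]]]]]]]]]]]]]]]] :=
  canonical_bases A B C D E.
set Y1 := A *m X6; set Y2 := B *m b2; set Y3 := B *m b3; set Y4 := C *m c4.
set Y5 := A *m X5; set Y6 := A *m X1.
move=> [Xb Yb bb cb [db eb]] [[DEX AX24 AX7] [[[G Y1G Bb1 Cc1 Cc3]]]].
move=> [[DX1 DX4 DX5 DX6 DX7] [EX1 EX2 EX5 EX6 EX7]].
have AX6 : A *m X6 = Y1 by [].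
have AX5 : A *m X5 = Y5 by [].
have AX1 : A *m X1 = Y6 by [].
have Bb2 : B *m b2 = Y2 by [].
have Bb3 : B *m b3 = Y3 by [].
have Cc4 : C *m c4 = Y4 by [].
clearbody Y1 Y2 Y3 Y4 Y5 Y6.
have Y1BC : col_sub Y1 (row_mx B C) by exists G.
have Y2B : col_sub Y2 B by exists b2.
have Y3B : col_sub Y3 B by exists b3.
have Y4C : col_sub Y4 C by exists c4.
(* [Y3] is defined through [B]; in the rank that involves only [A], [C], [D], [E] it must be
   recovered from [C] modulo [Y1]. *)
have Y3C : col_sub Y3 (row_mx Y1 C).
  by exists (col_mx (- C2) c3); rewrite mul_row_col Cc3 mulmxN addKr.
have BY : col_sub B (row3 Y1 Y2 Y3).
  have [L [bL _]] := bb; rewrite -[B]mulmx1 -bL mulmxA; apply: col_sub_mul.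
  rewrite mul_mx_row3 Bb1 Bb2 Bb3; rewrite /row3; col_sub_tac.
have CY : col_sub C (row3 Y1 Y3 Y4).
  have [L [cL _]] := cb; rewrite -[C]mulmx1 -cL mulmxA; apply: col_sub_mul.
  rewrite mul_mx_row3 Cc1 Cc3 Cc4; rewrite /row3; col_sub_tac.
rewrite {1 2}/row3 in BY CY.
have AX24s : col_sub (A *m row3 X2 X3 X4) (row3 Y2 Y3 Y4) by exists S.
pose DE := col_mx D E; pose XX := row_mx (row3 X1 X2 X3) X4.
pose XW := row3 X5 X6 X7.
have XXW : biinvertible (row_mx XX XW).
  by move: Xb; rewrite /XX /XW /row7 /row3 !row_assocE !biinvertible_cast.
have DEXW : DE *m XW = 0.
  rewrite mul_mx_row3 !mul_col_mx DX5 DX6 DX7 EX5 EX6 EX7.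
  by rewrite !col_mx0 /row3 !row_mx0.
have AXW : A *m XW = row3 Y5 Y1 0 by rewrite mul_mx_row3 AX5 AX6 AX7.
have Y16 : left_invertible (row_mx (row_mx (row_mx (row3 Y1 Y2 Y3) Y4) Y5) Y6).
  exact: left_invertible_rowl (biinvertible_left Yb).
have Y51 : left_invertible (row_mx (row_mx Y5 Y1) (row3 Y2 Y3 Y4)).
  have /left_invertible_rowC := left_invertible_rowl Y16.
  by rewrite /row3 !row_assocE !left_invertible_cast.
have col3_row3_0 : col_mx (row3 D (0 : 'M_(_, p1)) (0 : 'M_(_, p2))) (row3 E 0 0) =
    row3 DE 0 0 by rewrite /row3 !col_mx_row0.
move=> rABC rADE rABCDE rACDE rABDE rABCE rABCD.
(* The four ranks with both [D] and [E] use the splitting into [XX] and [XW], where [XW] spans W: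
   each is [m6 + n2 + n3 + n4] plus the rank of [[Y5 Y1]] bordered by the blocks of [B] and [C]
   present. *)
have rABCDE_E : rABCDE = (m5 + m1 + (m2 + m3 + m4) + (m6 + n2 + n3 + n4))%N.
  rewrite /rABCDE rank_colA col3_row3_0 rank_row3_block.
  apply: (rank_block_kernel (F := row_mx (row_mx Y5 Y1) (row3 Y2 Y3 Y4)) XXW) => //.
  by rewrite AXW; split=> //; rewrite /row3; solve_col_sub BY CY Y3C.
have rACDE_E : rACDE = (m5 + m1 + (m3 + m4) + (m6 + n2 + n3 + n4))%N.
  rewrite /rACDE rank_colA col_mx_row0.
  apply: (rank_block_kernel (F := row_mx (row_mx Y5 Y1) (row_mx Y3 Y4)) XXW) => //.
  rewrite AXW; split; rewrite /row3; [|solve_col_sub BY CY Y3C ..].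
  have : left_invertible (row_mx (row_mx Y5 Y1) (row_mx Y2 (row_mx Y3 Y4))).
    by move: Y51; rewrite /row3 !row_assocE !left_invertible_cast.
  by move=> /left_invertible_rowCA/left_invertible_rowr.
have rABDE_E : rABDE = (m5 + m1 + (m2 + m3) + (m6 + n2 + n3 + n4))%N.
  rewrite /rABDE rank_colA col_mx_row0.
  apply: (rank_block_kernel (F := row_mx (row_mx Y5 Y1) (row_mx Y2 Y3)) XXW) => //.
  rewrite AXW; split; rewrite /row3; [|solve_col_sub BY CY Y3C ..].
  by move/left_invertible_rowA/left_invertible_rowl: Y51.
have rADE_E : rADE = (m5 + m1 + (m6 + n2 + n3 + n4))%N.
  rewrite /rADE rank_colA -rank_row0 -col_mx0 -block_mxEh.
  apply: (rank_block_kernel (F := row_mx Y5 Y1) XXW) => //.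
  rewrite AXW; split; rewrite /row3; [|solve_col_sub BY CY Y3C ..].
  exact: left_invertible_rowl Y51.
(* For the ranks with both [B] and [C], [XK] spans the preimage under [A] of the image of [[B C]]
   and [XV] is a complement. On [XK], [D] keeps only [X2], [X3], and [E] only [X3], [X4]. *)
pose XV := row_mx X5 X1; pose XK := row_mx (row3 X2 X3 X4) (row_mx X6 X7).
have XVK : biinvertible (row_mx XV XK).
  have : biinvertible (row_mx (row_mx X1 (row3 X2 X3 X4)) (row_mx X5 (row_mx X6 X7))).
    by move: Xb; rewrite /row7 /row3 !row_assocE !biinvertible_cast.
  move/biinvertible_rowCA; rewrite /XV /XK /row3 !row_assocE !biinvertible_cast.
  exact.
pose Y14 := row_mx Y1 (row3 Y2 Y3 Y4).
have Y14V : left_invertible (row_mx Y14 (A *m XV)).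
  rewrite /XV mul_mx_row AX5 AX1; move: Y16.
  by rewrite /Y14 /row3 !row_assocE !left_invertible_cast.
have AXK : col_sub (A *m XK) Y14.
  rewrite mul_mx_row; apply: col_sub_row; first exact: col_sub_inr.
  by rewrite mul_mx_row AX6 AX7 /Y14; col_sub_tac.
have BCbasis : column_basis (row_mx B C) Y14.
  split; first exact: left_invertible_rowl Y14V.
    by rewrite /Y14 /row3; solve_col_sub BY CY Y3C.
  by rewrite /Y14 /row3; solve_col_sub BY CY Y3C.
have rABC_E : rABC = (m1 + (m2 + m3 + m4) + (m5 + m6))%N.
  by rewrite /rABC rank_row3; exact: rank_row_preimage XVK BCbasis Y14V AXK.
have rABCD_E : rABCD = (m1 + (m2 + m3 + m4) + (m5 + m6) + (n2 + n3))%N.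
  rewrite /rABCD rank_row3_block.
  apply: (rank_block_preimage XVK BCbasis Y14V AXK (V := row_mx (D *m X2) (D *m X3))).
  rewrite mul_mx_row mul_mx_row3 mul_mx_row DX4 DX6 DX7 /row3.
  split; [exact: left_invertible_rowl (biinvertible_left db) | | ]; col_sub_tac.
have rABCE_E : rABCE = (m1 + (m2 + m3 + m4) + (m5 + m6) + (n3 + n4))%N.
  rewrite /rABCE rank_row3_block.
  apply: (rank_block_preimage XVK BCbasis Y14V AXK (V := row_mx (E *m X3) (E *m X4))).
  rewrite mul_mx_row mul_mx_row3 mul_mx_row EX2 EX6 EX7 /row3.
  split; [ | col_sub_tac | col_sub_tac].
  by move: (biinvertible_left eb) => /left_invertible_rowA/left_invertible_rowr.
(* Invariance of dimension makes the block sizes add up, so the truncated subtractions in the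
   statement are exact. *)
have em := biinvertible_dim Yb; have en := biinvertible_dim Xb.
have ep1 := biinvertible_dim bb; have ep2 := biinvertible_dim cb.
have eq1 := biinvertible_dim db; have eq2 := biinvertible_dim eb.
have m7E : m7 = (m - (m1 + m2 + m3 + m4 + m5 + m6))%N by rewrite -em addKn.
have n7E : n7 = (n - (m1 + m5 + m6 + n2 + n3 + n4))%N by rewrite -en; lia.
have r1E : r1 = (p1 - m2 - m3)%N by rewrite -ep1 -subnDA addKn.
have r2E : r2 = (p2 - m3 - m4)%N by rewrite -ep2 -subnDA -addnA addnK.
have s1E : s1 = (q1 - n2 - n3)%N by rewrite -eq1 -subnDA addKn.
have s2E : s2 = (q2 - n3 - n4)%N by rewrite -eq2 -subnDA -addnA addnK.
subst m7 n7 r1 r2 s1 s2.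
exists m1, m2, m3, m4, m5, m6, n2, n3, n4; split; last split.
- by rewrite rABC_E rADE_E rABCDE_E rACDE_E rABDE_E; split; lia.
- by rewrite rABCDE_E rABCE_E rABCD_E rABC_E; split; lia.
move=> m7 n7; exists em, en, ep1, ep2, eq1, eq2.
have [A1 [A2 [A3 [A4 [A5 [A6 [A7 [A8 [A9 SE]]]]]]]]] := mx33_blocks S.
exists A1, A2, A3, A4, A5, A6, A7, A8, A9, B1, C1, C2, D1, E1, E2.
have [LX [XL LX1]] := Xb; have [Lb [bL Lb1]] := bb; have [Lc [cL Lc1]] := cb.
(* [P], [V1], [V2] have the adapted bases as columns, while [Q], [T1], [T2] are inverses of the
   bases [X], [b], [c]. *)
eexists (castmx (erefl m, em) _), (castmx (en, erefl n) LX),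
  (castmx (ep1, erefl p1) Lb), (castmx (ep2, erefl p2) Lc),
  (castmx (erefl q1, eq1) _), (castmx (erefl q2, eq2) _); split.
  split; first exact: biinvertible_nonsingular Yb.
  split; first exact: biinvertible_nonsingular_inv XL LX1.
  split; first exact: biinvertible_nonsingular_inv bL Lb1.
  split; first exact: biinvertible_nonsingular_inv cL Lc1.
  split; first exact: biinvertible_nonsingular db.
  exact: biinvertible_nonsingular eb.
have [AX2 AX3 AX4] : [/\ A *m X2 = Y2 *m A1 + Y3 *m A4 + Y4 *m A7,
    A *m X3 = Y2 *m A2 + Y3 *m A5 + Y4 *m A8
    & A *m X4 = Y2 *m A3 + Y3 *m A6 + Y4 *m A9].
  move: AX24; rewrite SE mul_row3_col3 !mul_mx_row3 !add_row3 /row3.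
  by move=> /eq_row_mx[/eq_row_mx[-> ->] ->].
split; [apply: (cast_factorization _ _ _ XL) | apply: (cast_factorization _ _ _ bL)
  | apply: (cast_factorization _ _ _ cL) | apply: (cast_factorization _ _ _ XL)
  | apply: (cast_factorization _ _ _ XL)].
- rewrite mul_row7_col7 !mul_mx_row7 !mulmx0 !mulmx1 !add_row7 !addr0 !add0r.
  by rewrite AX1 AX2 AX3 AX4 AX5 AX6 AX7.
- rewrite mul_row7_col7 !mul_mx_row3 !mulmx0 !mulmx1 !add_row3 !addr0 !add0r.
  by rewrite Bb1 Bb2 Bb3.
- rewrite mul_row7_col7 !mul_mx_row3 !mulmx0 !mulmx1 !add_row3 !addr0 !add0r.
  by rewrite Cc1 Cc3 Cc4.
- rewrite mul_row3_col3 !mul_mx_row7 !mulmx0 !mulmx1 !add_row7 !addr0 !add0r.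
  by rewrite DX1 DX4 DX5 DX6 DX7.
- rewrite mul_row3_col3 !mul_mx_row7 !mulmx0 !mulmx1 !add_row7 !addr0 !add0r.
  by rewrite EX1 EX2 EX5 EX6 EX7.
Qed.
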